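(* For any $\varphi\in L^1(\mathbb{R})\cap L^\infty(\mathbb{R})$ there exist $T_{max}>0$ and a unique local solution $u\in C([0,T_{max}],L^1(\mathbb{R})\cap L^\infty(\mathbb{R}))$ of the equation $$u_t(t,x)=\int_{\mathbb{R}}K(x-y)\big(u(t,y)-u(t,x)\big)\,dy+\int_{\mathbb{R}}G(x-y)\Big(\frac{u(t,y)+u(t,x)}{2}\Big)^2dy,\qquad u(0)=\varphi,$$ and this solution conserves the mass of the initial data, i.e. $\int_{\mathbb{R}}u(t,x)\,dx=\int_{\mathbb{R}}\varphi(x)\,dx$. Moreover, if $\|\varphi\|_{L^\infty(\mathbb{R})}<1/C_{GK}$, then the solution is global (defined for all $t\ge 0$), preserves the sign of the initial data (if $\varphi\ge 0$ then $u(t)\ge 0$ for all $t\geq 0$; if $\varphi\le 0$ then $u(t)\le 0$ for all $t\geq 0$), and satisfies, for all $t\ge 0$, $$\|u(t)\|_{L^1(\mathbb{R})}\le\|\varphi\|_{L^1(\mathbb{R})}\quad\text{and}\quad \|u(t)\|_{L^\infty(\mathbb{R})}\le\|\varphi\|_{L^\infty(\mathbb{R})}.$$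
   Context: Functions are real-valued. The kernels $K,G\in L^1(\mathbb{R})$ satisfy: $K$ is nonnegative and even with $\int_{\mathbb{R}}K(x)\,dx=1$; $G$ is odd; and there is a constant $C_{GK}>0$ with $|G(x)|\le C_{GK}K(x)$ for all $x\in\mathbb{R}$. The equation is understood as an ordinary differential equation in the Banach space $L^1(\mathbb{R})\cap L^\infty(\mathbb{R})$ (equivalently, in its time-integrated form $u(t)=\varphi+\int_0^t(\text{right-hand side})\,ds$). *)

(* Defs.v *)
From HB Require Import structures.
From mathcomp Require Import all_boot all_order all_algebra.
From mathcomp Require Import all_classical all_reals all_analysis.

Set Implicit Arguments.
Unset Strict Implicit.
Unset Printing Implicit Defensive.

Import Order.TTheory GRing.Theory Num.Theory.
Import numFieldNormedType.Exports.

Local Open Scope classical_set_scope.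
Local Open Scope ring_scope.

Section nonlocal_equation.
Context {R : realType}.

(* Elements of L^1(R) `&` L^oo(R) are represented by real-valued measurable
   functions; equality in that space is equality almost everywhere. *)
Definition L1Loo (f : R -> R) : Prop :=
  f \in Lfun (@lebesgue_measure R) 1%E /\
  f \in Lfun (@lebesgue_measure R) +oo%E.

Definition L1Loo_norm (f : R -> R) : \bar R :=
  ('N[@lebesgue_measure R]_1 [EFin \o f] +
   'N[@lebesgue_measure R]_+oo [EFin \o f])%E.

(* For K, G in L^1 and v in L^1 `&` L^oo both integrands are integrable for
   every x, so the default value of Rintegral plays no role. *)
Definition nonlocal_rhs (K G v : R -> R) : R -> R := fun x =>
  \int[@lebesgue_measure R]_y (K (x - y) * (v y - v x)) +
  \int[@lebesgue_measure R]_y (G (x - y) * ((v y + v x) / 2) ^+ 2).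

(* u is a continuous curve from the time interval I to L^1 `&` L^oo. *)
Definition L1Loo_continuous (I : set R) (u : R -> R -> R) : Prop :=
  (forall t, I t -> L1Loo (u t)) /\
  (forall t, I t ->
    L1Loo_norm (u s \- u t) @[s --> within I (nbhs t)] --> 0%E).

(* v is the derivative of the curve u at time t for the norm of
   L^1 `&` L^oo, one-sided when t is an endpoint of I. *)
Definition L1Loo_derivative (I : set R) (u : R -> R -> R) (t : R)
    (v : R -> R) : Prop :=
  L1Loo_norm (fun x => (s - t)^-1 * (u s x - u t x) - v x)
    @[s --> within I t^'] --> 0%E.

Definition is_solution (K G phi : R -> R) (I : set R) (u : R -> R -> R)
    : Prop :=
  [/\ L1Loo_continuous I u,
      forall t, I t -> L1Loo_derivative I u t (nonlocal_rhs K G (u t)) &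
      u 0 = phi %[ae (@lebesgue_measure R)]].

Definition is_unique_solution (K G phi : R -> R) (I : set R)
    (u : R -> R -> R) : Prop :=
  is_solution K G phi I u /\
  forall v, is_solution K G phi I v ->
    forall t, I t -> v t = u t %[ae (@lebesgue_measure R)].

Definition conserves_mass (phi : R -> R) (I : set R) (u : R -> R -> R)
    : Prop :=
  forall t, I t ->
    \int[@lebesgue_measure R]_x u t x = \int[@lebesgue_measure R]_x phi x.

End nonlocal_equation.

(* Main.v *)
Require Import Defs.
From HB Require Import structures.
From mathcomp Require Import all_boot all_order all_algebra.
From mathcomp Require Import all_classical all_reals all_analysis.
From mathcomp Require Import measurable_realfun ess_sup_inf.
From mathcomp Require Import zify ring lra.
Import Order.TTheory GRing.Theory Num.Theory.
Import numFieldNormedType.Exports.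
Local Open Scope classical_set_scope.
Local Open Scope ring_scope.

(** The right-hand side F is a quadratic map of L^1 `&` L^oo, hence Lipschitz
    on bounded sets, and the equation is an ordinary differential equation
    u' = F(u).  It is solved by the explicit Euler scheme, because one Euler
    step v + h F(v) inherits exactly the properties claimed of the solution.

    The structure of one step.  Oddness of G allows a constant to be
    subtracted inside the second integral, so the difference of two values of F
    is (nonlocal_opB)
      F(w)(x) - F(v)(x) = \int (K + G s) (w y - v y) + (- K + G s) (w x - v x) dy
    where s is the mean of the four values v x, v y, w x, w y.  If
    |v|, |w| <= A then |G s| <= C A K.  This gives the Lipschitz estimates in
    L^oo and L^1, and, when C A <= 1, it makes the coefficient of w y - v y
    nonnegative and that of w x - v x at least - 2 K: for h <= 1/2 the Euler
    step is monotone (euler_step_mono).  Constants are stationary, so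
    monotonicity yields the maximum principle and the preservation of sign
    (euler_step_bounds).  The full integrand is antisymmetric in (x, y), so
    mass is conserved (nonlocal_op_mass), and a monotone mass-preserving map
    fixing 0 does not increase the L^1 norm (euler_step_L1).

    Convergence.  For any F that is Lipschitz on a ball containing the Euler
    iterates up to time S, halving the step moves the iterates by at most a
    constant times the step (euler_refine), so the dyadic schemes converge
    to a curve u with
      |u(s) - u(t) - (s - t) F(u(t))| <= D (s - t)^2
    (euler_limit_differentiable).  For arbitrary data the iterates stay bounded
    on a short time interval (euler_local_bound); for data with
    C |phi|_oo < 1 they stay bounded for all times (euler_global_bound).  The
    limit inherits every closed condition satisfied by the iterates.

    Working with functions bounded everywhere, rather than almost everywhere,
    keeps limits pointwise: phi is replaced at the outset by a representative
    that satisfies its essential bounds at every point.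

    Uniqueness.  F is already locally Lipschitz for the L^oo norm alone, so
    the L^oo distance of two solutions satisfies a differential inequality at
    every time, and it vanishes by a Gronwall argument (gronwall_zero,
    solution_unique). *)

Set Implicit Arguments.
Unset Strict Implicit.
Unset Printing Implicit Defensive.

(** * Integrals of kernels on a product space *)

Section ParametricIntegral.
Context d1 d2 (T1 : measurableType d1) (T2 : measurableType d2) (R : realType).
Variable mu : {sigma_finite_measure set T2 -> \bar R}.

(** Fubini gives measurability of the sections' integral only for f integrable
    on the product, which fails for integrands that are merely bounded in one
    variable; positive and negative parts are treated by Tonelli instead. *)
Lemma measurable_Rintegral_section (f : T1 * T2 -> R) :
  measurable_fun setT f ->
  measurable_fun setT (fun x => \int[mu]_y f (x, y)).
Proof.
move=> mf; pose fE (p : T1 * T2) := (f p)%:E.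
have mfE : measurable_fun setT fE by exact/measurable_EFinP.
rewrite (_ : (fun x => _) = fine \o
    ((fun x => \int[mu]_y (fE^\+%E (x, y))) \-
     (fun x => \int[mu]_y (fE^\-%E (x, y))))%E); last first.
  apply/funext => x; rewrite /Rintegral [in LHS]integralE /=.
  by congr (fine (_ - _)%E); apply: eq_integral => y _; rewrite ?funeposE ?funenegE.
apply: measurableT_comp; first exact: fine_measurable.
apply: emeasurable_funB.
- apply: (measurable_fun_fubini_tonelli_F (m2 := mu) fE^\+%E).
    exact: measurable_funepos.
  by move=> p; exact: funepos_ge0.
- apply: (measurable_fun_fubini_tonelli_F (m2 := mu) fE^\-%E).
    exact: measurable_funeneg.
  by move=> p; exact: funeneg_ge0.
Qed.

End ParametricIntegral.

Section AntisymmetricIntegral.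
Context d (T : measurableType d) (R : realType).
Variable mu : {sigma_finite_measure set T -> \bar R}.

Lemma integral_antisymmetric (p : T -> T -> R) :
  (mu \x mu)%E.-integrable setT (fun q : T * T => (p q.1 q.2)%:E) ->
  (forall x y, p x y = - p y x) ->
  (\int[mu]_x \int[mu]_y (p x y)%:E = 0)%E.
Proof.
move=> ip panti.
have iS : mu.-integrable setT (fun x => \int[mu]_y (p x y)%:E)%E.
  exact: integrable_fubini_F ip.
have S2 : (\int[mu]_x \int[mu]_y (p x y)%:E =
   \int[mu]_x (- \int[mu]_y (p x y)%:E))%E.
  rewrite [LHS](Fubini ip) /=.
  have mE y : measurable_fun setT (fun x => (p y x)%:E).
    exact: (measurableT_comp (measurable_int _ ip) (measurable_pair1 y)).
  apply: ae_eq_integral => //.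
  - exact: (measurable_fubini_G ip).
  - by apply: measurableT_comp => //; exact: (measurable_int mu).
  apply: filterS (ae_integrable1 ip) => y iy _ /=.
  under eq_integral do rewrite panti EFinN.
  by rewrite integralN//; exact: integrable_add_def.
rewrite integralN in S2; last exact: integrable_add_def.
have := integrable_fin_num measurableT iS.
move: S2; case: (\int[mu]_x \int[mu]_y (p x y)%:E)%E => // r [S2] _.
by congr EFin; lra.
Qed.

End AntisymmetricIntegral.

(** * Functions bounded in L^1 and uniformly *)

Section NormBound.
Context d (T : measurableType d) (R : realType).
Variable mu : {measure set T -> \bar R}.
Implicit Types (f g : T -> R) (a b : R).

(** A bound by b of both the L^1 norm and the supremum norm.  The supremum is
    taken over all points, so that bounds pass to pointwise limits and
    no quotient is involved. *)
Definition norm_le f b := [/\ measurable_fun setT f, forall x, `|f x| <= b &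
  (\int[mu]_x (`|f x|)%:E <= b%:E)%E].

Lemma norm_le_ge0 f b : norm_le f b -> 0 <= b.
Proof.
case=> _ _; rewrite -lee_fin; apply: le_trans.
by apply: integral_ge0 => x _; rewrite lee_fin.
Qed.

Lemma norm_leW f a b : a <= b -> norm_le f a -> norm_le f b.
Proof.
move=> ab [mf fa If]; split=> // [x|]; first exact: le_trans (fa x) ab.
by rewrite (le_trans If)// lee_fin.
Qed.

Lemma eq_norm_le f g b : f =1 g -> norm_le f b -> norm_le g b.
Proof. by move=> /funext ->. Qed.

Lemma norm_leD f g a b : norm_le f a -> norm_le g b ->
  norm_le (fun x => f x + g x) (a + b).
Proof.
move=> [mf fa If] [mg gb Ig]; split=> [|x|]; first exact: measurable_funD.
  by rewrite (le_trans (ler_normD _ _))// lerD.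
have mnf : measurable_fun setT (fun x => (`|f x|)%:E).
  by apply/measurable_EFinP; exact: measurableT_comp.
have mng : measurable_fun setT (fun x => (`|g x|)%:E).
  by apply/measurable_EFinP; exact: measurableT_comp.
rewrite EFinD; apply: le_trans (leeD If Ig); rewrite -ge0_integralD//;
  try by move=> ? _; rewrite lee_fin.
apply: ge0_le_integral => //.
- apply/measurable_EFinP; apply: measurableT_comp => //.
  exact: measurable_funD.
- exact: emeasurable_funD.
- by move=> x _; rewrite -EFinD lee_fin ler_normD.
Qed.

Lemma norm_leZ f a c : norm_le f a -> norm_le (fun x => c * f x) (`|c| * a).
Proof.
move=> [mf fa If]; split=> [|x|]; first exact: measurable_funM.
  by rewrite normrM ler_wpM2l.
under eq_integral do rewrite normrM EFinM.
rewrite ge0_integralZl//.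
- by rewrite EFinM lee_wpmul2l// lee_fin.
- by apply/measurable_EFinP; exact: measurableT_comp.
Qed.

Lemma norm_leN f a : norm_le f a -> norm_le (fun x => - f x) a.
Proof.
move=> /(norm_leZ (-1)); rewrite normrN1 mul1r; apply: eq_norm_le => x.
by rewrite mulN1r.
Qed.

Lemma norm_le0 : norm_le (fun=> 0) 0.
Proof.
split=> // [x|]; first by rewrite normr0.
by under eq_integral do rewrite normr0; rewrite integral0.
Qed.

Lemma norm_le_integrable f a : norm_le f a -> mu.-integrable setT (EFin \o f).
Proof.
move=> [mf _ If]; apply/integrableP; split; first exact/measurable_EFinP.
by apply: (le_lt_trans If); rewrite ltry.
Qed.

(** Fatou's lemma. *)
Lemma L1_norm_limit (f_ : nat -> T -> R) f (c : \bar R) :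
  (forall n, measurable_fun setT (f_ n)) ->
  (forall n, (\int[mu]_x (`|f_ n x|)%:E <= c)%E) ->
  (forall x, f_ n x @[n --> \oo] --> f x) ->
  (\int[mu]_x (`|f x|)%:E <= c)%E.
Proof.
move=> mf_ fc ff.
rewrite (_ : (fun x => _) = (fun x => limn_einf (fun n => (`|f_ n x|)%:E))).
  apply: (@le_trans _ _ (limn_einf (fun n => \int[mu]_x (`|f_ n x|)%:E)%E)).
    apply: fatou => // n.
    - by apply/measurable_EFinP; exact: measurableT_comp.
  rewrite limn_einf_lim; apply: lime_le; first exact: is_cvg_einfs.
  apply: nearW => n; apply: le_trans (fc n).
  by apply: ereal_inf_lbound => /=; exists n => /=.
apply/funext => x.
have nf : (`|f_ n x|)%:E @[n --> \oo] --> (`|f x|)%:E.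
  by apply: cvg_EFin; [exact: nearW|exact: cvg_norm].
by rewrite is_cvg_limn_einfE; [exact/esym/cvg_lim|apply/cvg_ex; eexists; exact: nf].
Qed.

Lemma norm_le_limit (f_ : nat -> T -> R) f b : (forall n, norm_le (f_ n) b) ->
  (forall x, f_ n x @[n --> \oo] --> f x) -> norm_le f b.
Proof.
move=> fb ff; split.
- by apply: (measurable_fun_cvg (h := f_)) => // n; have [] := fb n.
- move=> x; rewrite -lee_fin.
  have nf : `|f_ n x| @[n --> \oo] --> `|f x| by exact: cvg_norm.
  rewrite lee_fin -(cvg_lim _ nf)//; apply: limr_le; first by apply/cvg_ex; eexists; exact: nf.
  by apply: nearW => n; have [] := fb n.
- by apply: (L1_norm_limit (f_ := f_)) => // n; have [] := fb n.
Qed.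

End NormBound.

(** * Convergence of the Euler scheme *)

Lemma nat_double_cases (p q : nat) : (p * 2 < q.+1)%N -> (q < p * 2 + 2)%N ->
  q = (p * 2)%N \/ q = (p * 2 + 1)%N.
Proof. lia. Qed.

Section Euler.
Context {R : realType} {T : Type}.
Variables (F : (T -> R) -> T -> R) (phi : T -> R).

(** Dyadic steps make successive schemes comparable: each grid refines the
    preceding one.  The exponent n.+1 ensures mesh n <= 1 / 2, as required for
    the monotonicity of the Euler step. *)
Definition mesh (n : nat) : R := (2 ^+ n.+1)^-1.

Definition euler (h : R) (k : nat) : T -> R :=
  iter k (fun v x => v x + h * F v x) phi.

Definition euler_approx (n : nat) (t : R) : T -> R :=
  euler (mesh n) (Num.truncn (t / mesh n)).

Definition euler_limit (t : R) (x : T) : R :=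
  limn (fun n => euler_approx n t x).

Lemma mesh_gt0 n : 0 < mesh n.
Proof. by rewrite invr_gt0 exprn_gt0. Qed.

Lemma meshS n : mesh n = 2 * mesh n.+1.
Proof. by rewrite /mesh (exprS 2 n.+1) invfM mulrA divff ?mul1r// pnatr_eq0. Qed.

Lemma mesh_le_half n : mesh n <= 1 / 2.
Proof.
rewrite /mesh div1r lef_pV2 ?posrE ?exprn_gt0//.
by rewrite -[leLHS]expr1 ler_weXn2l// ler1n.
Qed.

Lemma mesh_cvg0 : mesh n @[n --> \oo] --> 0.
Proof.
rewrite (_ : mesh = fun n => 2^-1 * (2^-1) ^+ n); last first.
  by apply/funext => n; rewrite /mesh exprS invfM exprVn.
rewrite -[X in _ --> X](mulr0 (2^-1)); apply: cvgMr.
by apply: cvg_expr; rewrite ger0_norm// invf_lt1// ltr1n.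
Qed.

Lemma mesh_small (e : R) : 0 < e -> exists n, mesh n <= e.
Proof.
move=> e0; have /cvgrPdist_le /(_ _ e0) [N _ /(_ N (leqnn N))] := mesh_cvg0.
by rewrite sub0r normrN gtr0_norm ?mesh_gt0// => H; exists N.
Qed.

Lemma truncn_mesh n (t : R) : 0 <= t ->
  let p := Num.truncn (t / mesh n) in
  p%:R * mesh n <= t < p%:R * mesh n + mesh n.
Proof.
move=> t0 /=; have tm0 : 0 <= t / mesh n by rewrite divr_ge0// ltW// mesh_gt0.
have := truncn_itv tm0; rewrite ler_pdivlMr ?mesh_gt0// ltr_pdivrMr ?mesh_gt0//.
by rewrite -addn1 natrD mulrDl mul1r.
Qed.

End Euler.

(** The vector field F is arbitrary: the rate of convergence depends only on its
    Lipschitz constant L and its bound B on a ball of radius M that contains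
    the Euler iterates up to the time S. *)
Section EulerConvergence.
Context d (T : measurableType d) (R : realType).
Variable mu : {measure set T -> \bar R}.
Variables (F : (T -> R) -> T -> R) (phi : T -> R) (S M L B : R).
Hypothesis L_ge0 : 0 <= L.
Hypothesis S_ge0 : 0 <= S.
Local Notation E n := (euler F phi (mesh n)).
Local Notation h := (@mesh R).
Hypothesis F_lip : forall v w e, norm_le mu v M -> norm_le mu w M ->
  norm_le mu (fun x => w x - v x) e ->
  norm_le mu (fun x => F w x - F v x) (L * e).
Hypothesis F_bound : forall v, norm_le mu v M -> norm_le mu (F v) B.
Hypothesis E_bound : forall n k, k%:R * h n <= S ->
  norm_le mu (E n k) M.

Let h0 n : 0 < h n := mesh_gt0 n.

Let B_ge0 : 0 <= B.
Proof.
by apply: norm_le_ge0 (F_bound (E_bound (n := 0) (k := 0) _)); rewrite mul0r.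
Qed.

Let EB n k : k%:R * h n <= S -> norm_le mu (F (E n k)) B.
Proof. by move=> kS; exact/F_bound/E_bound. Qed.

Let leS n j m : (j + m.+1)%N%:R * h n <= S -> (j + m)%N%:R * h n <= S.
Proof.
apply: le_trans; rewrite ler_pM2r// ler_nat leq_add2l; exact: leqnSn.
Qed.

Lemma euler_variation n j m : (j + m)%N%:R * h n <= S ->
  norm_le mu (fun x => E n (j + m)%N x - E n j x) (m%:R * h n * B).
Proof.
elim: m => [|m IH] jm.
  rewrite addn0 mulr0n !mul0r; apply: eq_norm_le (norm_le0 mu) => x.
  by rewrite subrr.
have := norm_leD (IH (leS jm)) (norm_leZ (h n) (EB (leS jm))).
rewrite gtr0_norm// => Hm.
rewrite (_ : m.+1%:R * _ * _ = m%:R * h n * B + h n * B); last first.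
  by rewrite -natr1; ring.
by apply: eq_norm_le Hm => x; rewrite addnS /=; ring.
Qed.

(** Increments are compared with F v for a v close to the iterate j: on the
    finite grid this is the quantitative differentiability that passes to the
    limit. *)
Lemma euler_taylor n j m v (e : R) : norm_le mu v M ->
  (j + m)%N%:R * h n <= S -> norm_le mu (fun x => E n j x - v x) e ->
  norm_le mu (fun x => E n (j + m)%N x - E n j x - m%:R * h n * F v x)
    (m%:R * h n * (L * (m%:R * h n * B + e))).
Proof.
move=> vM + ve; have e0 := norm_le_ge0 ve; elim: m => [|m IH] jm.
  rewrite addn0 mulr0n !mul0r; apply: eq_norm_le (norm_le0 mu) => x.
  by rewrite mul0r subrr subr0.
have H1 := norm_leD (euler_variation (leS jm)) ve.
have H2 : norm_le mu (fun x => E n (j + m)%N x - v x) (m%:R * h n * B + e).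
  by apply: eq_norm_le H1 => x; ring.
have H3 := norm_leZ (h n) (F_lip vM (E_bound (leS jm)) H2).
have H4 := norm_leD (IH (leS jm)) H3.
have H5 : norm_le mu
    (fun x => E n (j + m.+1)%N x - E n j x - m.+1%:R * h n * F v x)
    (m%:R * h n * (L * (m%:R * h n * B + e)) + `|h n| * (L * (m%:R * h n * B + e))).
  by apply: eq_norm_le H4 => x; rewrite addnS -natr1 /=; ring.
apply: norm_leW H5; rewrite gtr0_norm// -natr1.
set a := m%:R * h n; have a0 : 0 <= a by rewrite mulr_ge0// ltW.
rewrite mulrDl mul1r -/a -mulrDl ler_wpM2l ?addr_ge0// ?(ltW (h0 n))//.
rewrite ler_wpM2l// lerD2r ler_wpM2r// lerDl ltW//.
Qed.

(** One step of size h and two steps of size h / 2 differ by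
    h / 2 (F(v + h / 2 F(v)) - F(v)), of order h^2; a step multiplies the
    accumulated error by at most 1 + h L. *)
Lemma euler_refine n k : k%:R * h n <= S ->
  norm_le mu (fun x => E n.+1 (k * 2)%N x - E n k x)
   (k%:R * h n * (h n * L * B) * (1 + h n * L) ^+ k).
Proof.
have hL : 0 <= h n * L by rewrite mulr_ge0// ltW.
elim: k => [|k IH] kS.
  rewrite mul0n mulr0n !mul0r; apply: eq_norm_le (norm_le0 mu) => x.
  by rewrite subrr.
have kS' : k%:R * h n <= S by have := @leS n 0 k; rewrite !add0n; apply.
have kS1 : (k * 2 + 1)%N%:R * h n.+1 <= S.
  apply: le_trans kS; rewrite (meshS n) mulrA ler_pM2r// -natrM ler_nat; lia.
have kS0 : (k * 2)%N%:R * h n.+1 <= S.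
  by have := @leS n.+1 (k * 2)%N 0; rewrite addn0; apply.
have {}IH := IH kS'; set e := (X in norm_le mu _ X) in IH.
have H1 := F_lip (E_bound kS') (E_bound kS0) IH.
have H2 := F_lip (E_bound kS0) (E_bound kS1) (euler_variation kS1).
have H3 := norm_leD (norm_leD IH (norm_leZ (h n) H1)) (norm_leZ (h n.+1) H2).
have H4 : norm_le mu (fun x => E n.+1 (k.+1 * 2)%N x - E n k.+1 x)
   (e + `|h n| * (L * e) + `|h n.+1| * (L * (1%:R * h n.+1 * B))).
  by apply: eq_norm_le H3 => x; rewrite mulSn addn1 /= (meshS n); ring.
apply: norm_leW H4; rewrite !gtr0_norm// mul1r.
have q1 : 1 <= (1 + h n * L) ^+ k by rewrite exprn_ege1// lerDl.
rewrite exprS -natr1 /e; move: q1; set q := _ ^+ k => q1.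
have -> : (k%:R + 1) * h n * (h n * L * B) * ((1 + h n * L) * q) =
  k%:R * h n * (h n * L * B) * q + h n * (L * (k%:R * h n * (h n * L * B) * q)) +
  h n * (L * (h n * B)) * ((1 + h n * L) * q) by ring.
rewrite lerD2l.
have hh : h n.+1 <= h n by rewrite (meshS n) ler_peMl// ?ler1n// ltW.
have LB0 : 0 <= L * B by rewrite mulr_ge0.
apply: (@le_trans _ _ (h n * (L * (h n * B)))).
  by rewrite ler_pM// ?mulr_ge0// ?ler_wpM2l ?ler_wpM2r// ltW.
rewrite ler_peMr ?mulr_ge0// ?(ltW (h0 n))//.
by rewrite -[leLHS]mulr1 ler_pM// lerDl.
Qed.

Let c0 : R := S * L * B * expR (S * L).

Let c0_ge0 : 0 <= c0.
Proof. by rewrite !mulr_ge0// expR_ge0. Qed.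

Lemma euler_refine_unif n k : k%:R * h n <= S ->
  norm_le mu (fun x => E n.+1 (k * 2)%N x - E n k x) (h n * c0).
Proof.
move=> kS; apply: norm_leW (euler_refine kS).
have hL : 0 <= h n * L by rewrite mulr_ge0// ltW.
have -> : k%:R * h n * (h n * L * B) * (1 + h n * L) ^+ k =
  h n * (k%:R * h n * (L * B) * (1 + h n * L) ^+ k) by ring.
have -> : c0 = S * (L * B) * expR (S * L) by rewrite /c0; ring.
rewrite ler_pM2l//; have khn : 0 <= k%:R * h n by rewrite mulr_ge0// ltW.
have LB0 : 0 <= L * B by rewrite mulr_ge0.
apply: ler_pM; [exact: mulr_ge0|by rewrite exprn_ge0// addr_ge0| |].
  by rewrite ler_wpM2r.
apply: (@le_trans _ _ (expR (h n * L) ^+ k)).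
  by rewrite lerXn2r ?nnegrE ?expR_ge0 ?addr_ge0// expR_ge1Dx.
by rewrite -expRM_natl ler_expR mulrA ler_wpM2r.
Qed.

Let c1 : R := c0 + B.

Let c1_ge0 : 0 <= c1. Proof. exact: addr_ge0. Qed.

Local Notation approx := (euler_approx F phi).

(** The grid point below t in the finer grid is the one of the coarser grid or
    the next one, which accounts for the additional term B of c1. *)
Lemma euler_approx_step n (t : R) : 0 <= t <= S ->
  norm_le mu (fun x => approx n.+1 t x - approx n t x) (h n * c1).
Proof.
move=> /andP[t0 tS]; rewrite /euler_approx.
have /andP[pt tp] := truncn_mesh n t0.
have /andP[qt tq] := truncn_mesh n.+1 t0.
move: pt tp qt tq.
set p := Num.truncn (t / h n); set q := Num.truncn (t / h n.+1) => pt tp qt tq.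
have pS : p%:R * h n <= S by exact: le_trans tS.
have H1 := euler_refine_unif pS.
have hn := meshS n (R := R).
have [qp|qp] : q = (p * 2)%N \/ q = (p * 2 + 1)%N.
- have h1 : (p * 2 < q.+1)%N.
    rewrite -(ltr_nat R) -(ltr_pM2r (h0 n.+1)) natrM -mulrA -hn.
    by rewrite (le_lt_trans pt)// -natr1 mulrDl mul1r.
  have h2 : (q < p * 2 + 2)%N.
    rewrite -(ltr_nat R) -(ltr_pM2r (h0 n.+1)) natrD natrM mulrDl -!mulrA -hn.
    by rewrite (le_lt_trans qt).
  exact: nat_double_cases.
- rewrite qp; apply: norm_leW H1.
  by rewrite ler_pM2l// lerDl.
- have qS : (p * 2 + 1)%N%:R * h n.+1 <= S by rewrite -qp (le_trans qt).
  have H2 := norm_leD H1 (euler_variation qS).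
  have H3 : norm_le mu (fun x => E n.+1 q x - E n p x)
     (h n * c0 + 1%:R * h n.+1 * B).
    by apply: eq_norm_le H2 => x; rewrite qp; ring.
  apply: norm_leW H3; rewrite mul1r mulrDr lerD2l ler_wpM2r//.
  by rewrite hn ler_peMl// ?ler1n// ltW.
Qed.

Lemma euler_approx_dist n m (t : R) : 0 <= t <= S ->
  norm_le mu (fun x => approx (n + m)%N t x - approx n t x) (2 * c1 * h n).
Proof.
move=> tS.
(* The geometric sum of the steps between n and n + m telescopes. *)
suff H : norm_le mu (fun x => approx (n + m)%N t x - approx n t x)
    (2 * c1 * (h n - h (n + m)%N)).
  apply: norm_leW H; rewrite ler_wpM2l ?mulr_ge0// gerBl ltW//.
elim: m => [|m IH].
  rewrite addn0 subrr mulr0; apply: eq_norm_le (norm_le0 mu) => x.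
  by rewrite subrr.
have H := norm_leD IH (euler_approx_step (n + m) tS).
have -> : 2 * c1 * (h n - h (n + m.+1)%N) =
  2 * c1 * (h n - h (n + m)%N) + h (n + m)%N * c1.
  by rewrite addnS (meshS (n + m)); ring.
by apply: eq_norm_le H => x; rewrite addnS; ring.
Qed.

Lemma approx_bound n (t : R) : 0 <= t <= S -> norm_le mu (approx n t) M.
Proof.
move=> /andP[t0 tS]; apply: E_bound; apply: le_trans tS.
by have /andP[] := truncn_mesh n t0.
Qed.

Local Notation u := (euler_limit F phi).

Lemma approx_cvg (t : R) x : 0 <= t <= S -> approx n t x @[n --> \oo] --> u t x.
Proof.
move=> tS; apply/cauchy_cvgP; apply: cauchy_exP => e e0.
have e1 : 0 < e / (2 * c1 + 1).
  by rewrite divr_gt0// ltr_wpDl// mulr_ge0.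
have [n hn] := mesh_small e1; exists (approx n t x); exists n => // k /= nk.
have [_ /(_ x) + _] := euler_approx_dist n (k - n) tS.
rewrite subnKC// -ball_normE /= distrC => /le_lt_trans; apply.
rewrite ler_pdivlMr in hn; last by rewrite ltr_wpDl// mulr_ge0.
by apply: lt_le_trans hn; rewrite mulrC ltr_pM2l// ltrDl.
Qed.

Lemma euler_limit_dist n (t : R) : 0 <= t <= S ->
  norm_le mu (fun x => u t x - approx n t x) (2 * c1 * h n).
Proof.
move=> tS; apply: (@norm_le_limit _ _ _ mu
  (fun m x => approx (n + m)%N t x - approx n t x)) => [m|x].
  exact: euler_approx_dist.
apply: cvgB; last exact: cvg_cst.
have := @approx_cvg t x tS; rewrite -(cvg_shiftn n).
by under eq_fun do rewrite addnC.
Qed.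

Lemma euler_limit_bound (t : R) : 0 <= t <= S -> norm_le mu (u t) M.
Proof.
move=> tS; apply: (@norm_le_limit _ _ _ mu (fun n => approx n t)) => [n|x].
  exact: approx_bound.
exact: approx_cvg.
Qed.

Lemma euler_limit0 : u 0 = phi.
Proof.
apply/funext => x; rewrite /euler_limit /euler_approx.
under eq_fun do rewrite mul0r truncn0 /=.
by rewrite lim_cst.
Qed.

Let D := 4 * L * B + 4 * L * c1 + B + 4 * c1.

(** The discretization level n is chosen after s and t, with a step smaller than
    both s - t and its square: all errors of order mesh n are then absorbed in
    (s - t)^2. *)
Lemma euler_limit_taylor (t s : R) : 0 <= t -> t < s -> s <= S ->
  norm_le mu (fun x => u s x - u t x - (s - t) * F (u t) x) (D * (s - t) ^+ 2).
Proof.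
move=> t0 ts sS; set si := s - t.
have siE : si = s - t by [].
have si0 : 0 < si by rewrite subr_gt0.
have tS : 0 <= t <= S by rewrite t0 (ltW (lt_le_trans ts sS)).
have sS' : 0 <= s <= S by rewrite sS (le_trans t0 (ltW ts)).
have e0 : 0 < Num.min si (si ^+ 2) by rewrite lt_min si0 exprn_gt0.
have [n hn] := mesh_small e0.
move: hn; rewrite le_min => /andP[hn1 hn2].
have Hs := euler_limit_dist n sS'; have Ht := euler_limit_dist n tS.
have uM := euler_limit_bound tS.
move: Hs Ht; rewrite /euler_approx.
have /andP[pt tp] := truncn_mesh n t0.
have /andP[qs sq] := truncn_mesh n (le_trans t0 (ltW ts)).
move: pt tp qs sq.
set p := Num.truncn (t / h n); set q := Num.truncn (s / h n) => pt tp qs sq.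
move=> Hs Ht.
have pq : (p <= q)%N by apply: le_truncn; rewrite ler_pM2r ?invr_gt0// ltW.
have qS : (p + (q - p))%N%:R * h n <= S by rewrite subnKC// (le_trans qs).
have Ht' : norm_le mu (fun x => E n p x - u t x) (2 * c1 * h n).
  by apply: eq_norm_le (norm_leN Ht) => x; rewrite opprB.
have H1 := euler_taylor uM qS Ht'.
move: H1; rewrite subnKC// natrB//.
set m := (_ - _) * h n => H1.
have m1 : m <= 2 * si by rewrite /m mulrBl; lra.
have m0 : 0 <= m by rewrite /m mulr_ge0 ?subr_ge0 ?ler_nat// ltW.
have H2 := norm_leZ (m - si) (F_bound uM).
have H3 := norm_leD (norm_leD (norm_leD Hs Ht') H1) H2.
have H4 : norm_le mu (fun x => u s x - u t x - si * F (u t) x)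
  (2 * c1 * h n + 2 * c1 * h n + m * (L * (m * B + 2 * c1 * h n)) + `|m - si| * B).
  by apply: eq_norm_le H3 => x; ring.
apply: norm_leW H4.
have m2 : `|m - si| <= si ^+ 2.
  apply: le_trans hn2; rewrite ler_norml /m mulrBl; apply/andP; split; lra.
have b1 : m * (L * (m * B + 2 * c1 * h n)) <= (2 * si) * (L * ((2 * si) * B + 2 * c1 * si)).
  have c10 : 0 <= 2 * c1 by rewrite mulr_ge0.
  have i0 : 0 <= m * B + 2 * c1 * h n.
    by apply: addr_ge0; apply: mulr_ge0 => //; exact: ltW.
  apply: ler_pM => //; first exact: mulr_ge0.
  apply: ler_wpM2l => //; apply: lerD; first exact: ler_wpM2r.
  exact: ler_wpM2l.
have b2 : `|m - si| * B <= si ^+ 2 * B by rewrite ler_wpM2r.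
have b3 : 2 * c1 * h n <= 2 * c1 * si ^+ 2 by rewrite ler_wpM2l// mulr_ge0.
apply: le_trans (lerD (lerD (lerD b3 b3) b1) b2) _.
by rewrite /D le_eqVlt; apply/orP; left; apply/eqP; ring.
Qed.

Let D' := (B + D * S).

Lemma euler_limit_lipschitz (t s : R) : 0 <= t -> t < s -> s <= S ->
  norm_le mu (fun x => u s x - u t x) (D' * (s - t)).
Proof.
move=> t0 ts sS; have si0 : 0 < s - t by rewrite subr_gt0.
have tS : 0 <= t <= S by rewrite t0 (ltW (lt_le_trans ts sS)).
have H := norm_leD (euler_limit_taylor t0 ts sS)
  (norm_leZ (s - t) (F_bound (euler_limit_bound tS))).
have H' : norm_le mu (fun x => u s x - u t x)
  (D * (s - t) ^+ 2 + `|s - t| * B) by apply: eq_norm_le H => x; ring.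
apply: norm_leW H'; rewrite gtr0_norm// /D'.
rewrite [leLHS](_ : _ = (D * (s - t) + B) * (s - t)); last by ring.
rewrite ler_pM2r// addrC lerD2l ler_wpM2l//; last by lra.
by rewrite /D !addr_ge0// !mulr_ge0.
Qed.

(** For s < t the expansion at t is deduced from the one at s, since F(u s) and
    F(u t) differ by O(t - s). *)
Lemma euler_limit_differentiable : exists D2 : R, 0 <= D2 /\ forall t s : R,
  0 <= t <= S -> 0 <= s <= S ->
  norm_le mu (fun x => u s x - u t x) (D2 * `|s - t|) /\
  norm_le mu (fun x => u s x - u t x - (s - t) * F (u t) x)
     (D2 * (s - t) ^+ 2).
Proof.
have D0 : 0 <= D by rewrite /D !addr_ge0// !mulr_ge0.
have D'0 : 0 <= D' by rewrite /D' addr_ge0// mulr_ge0.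
have LD0 : 0 <= L * D' by rewrite mulr_ge0.
have DLD0 : 0 <= D + L * D' by exact: addr_ge0.
exists (D' + (D + L * D')); split; first exact: addr_ge0.
move=> t s tS sS; have [tt|ts|st] := ltgtP t s.
- have := tt; rewrite -subr_gt0 => st0.
  case/andP: tS => t0 tS; case/andP: sS => s0 sS; split.
  + apply: norm_leW (euler_limit_lipschitz t0 tt sS).
    by rewrite gtr0_norm// ler_wpM2r ?(ltW st0)// lerDl.
  + apply: norm_leW (euler_limit_taylor t0 tt sS).
    by rewrite ler_wpM2r ?sqr_ge0// addrCA lerDl addr_ge0.
- have := ts; rewrite -subr_gt0 => st0.
  have uM := euler_limit_bound tS; have usM := euler_limit_bound sS.
  case/andP: tS => t0 tS; case/andP: sS => s0 sS.
  have H := norm_leN (euler_limit_lipschitz s0 ts tS).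
  have H1 : norm_le mu (fun x => u s x - u t x) (D' * (t - s)).
    by apply: eq_norm_le H => x; rewrite opprB.
  split.
    apply: norm_leW H1; rewrite distrC gtr0_norm// ler_wpM2r ?(ltW st0)//.
    by rewrite lerDl.
  have H2 := norm_leD (norm_leN (euler_limit_taylor s0 ts tS))
    (norm_leZ (t - s) (F_lip usM uM (euler_limit_lipschitz s0 ts tS))).
  have H3 : norm_le mu (fun x => u s x - u t x - (s - t) * F (u t) x)
    (D * (t - s) ^+ 2 + `|t - s| * (L * (D' * (t - s)))).
    by apply: eq_norm_le H2 => x; ring.
  apply: norm_leW H3; rewrite gtr0_norm// -(sqrrN (s - t)) opprB.
  rewrite [leLHS](_ : _ = (D + L * D') * (t - s) ^+ 2); last by ring.
  by rewrite ler_wpM2r ?sqr_ge0// lerDr.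
- subst s; rewrite subrr normr0 expr0n /= mulr0; split.
    by apply: eq_norm_le (norm_le0 mu) => x; rewrite subrr.
  by apply: eq_norm_le (norm_le0 mu) => x; rewrite subrr mul0r subr0.
Qed.

Lemma euler_limit_mass (t : R) (c : \bar R) : 0 <= t <= S ->
  (forall n k, k%:R * h n <= S -> (\int[mu]_x (E n k x)%:E = c)%E) ->
  (\int[mu]_x (u t x)%:E = c)%E.
Proof.
move=> tS Ec.
have iu := norm_le_integrable (euler_limit_bound tS).
have ia n := norm_le_integrable (approx_bound n tS).
have ac n : (\int[mu]_x (approx n t x)%:E = c)%E.
  apply: Ec; case/andP: tS => t0; apply: le_trans.
  by have /andP[] := truncn_mesh n t0.
suff /eqP : (\int[mu]_x (u t x)%:E - c = 0)%E.
  rewrite sube_eq; first by rewrite add0e => /eqP.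
  - exact: integrable_fin_num.
  - by rewrite -(ac 0%N) fin_num_adde_defr// integrable_fin_num.
apply/eqP; rewrite -abse_eq0 eq_le abse_ge0 andbT; apply/lee_addgt0Pr => e e0.
rewrite add0e; have e1 : 0 < e / (2 * c1 + 1).
  by rewrite divr_gt0// ltr_wpDl// mulr_ge0.
have [n hn] := mesh_small e1; rewrite -(ac n) -integralB//; last exact: ia.
have [md _ Id] := euler_limit_dist n tS.
apply: (le_trans (le_abse_integral _ _ _)) => //.
  by apply: (measurable_int mu); exact: (integrableB measurableT iu (ia n)).
apply: (le_trans Id); rewrite lee_fin.
rewrite ler_pdivlMr in hn; last by rewrite ltr_wpDl// mulr_ge0.
apply: le_trans hn; rewrite mulrC ler_pM2l// lerDl//.
Qed.

Lemma euler_limit_L1 (t : R) (c : \bar R) : 0 <= t <= S ->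
  (forall n k, k%:R * h n <= S -> (\int[mu]_x (`|E n k x|)%:E <= c)%E) ->
  (\int[mu]_x (`|u t x|)%:E <= c)%E.
Proof.
move=> tS Ec; apply: (@L1_norm_limit _ _ _ mu (fun n => approx n t)).
- by move=> n; have [] := approx_bound n tS.
- move=> n; apply: Ec; case/andP: tS => t0; apply: le_trans.
  by have /andP[] := truncn_mesh n t0.
- by move=> x; exact: approx_cvg.
Qed.

Lemma euler_limit_itv (t a b : R) : 0 <= t <= S ->
  (forall n k, k%:R * h n <= S -> forall x, a <= E n k x <= b) ->
  forall x, a <= u t x <= b.
Proof.
move=> tS Eab x.
have ab n : a <= approx n t x <= b.
  apply: Eab; case/andP: tS => t0; apply: le_trans.
  by have /andP[] := truncn_mesh n t0.
have /cvgP ca := @approx_cvg t x tS.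
apply/andP; split; [apply: limr_ge|apply: limr_le] => //; apply: nearW => n;
  by case/andP: (ab n).
Qed.

End EulerConvergence.

(** * A Gronwall inequality *)

Section Gronwall.
Context {R : realType}.

(** Real induction: the set of times up to which d <= e exp((L + 1) t) contains
    its supremum by the last hypothesis, and extends beyond it by the one
    before.
    The exponent L + 1 rather than L leaves room for the error e * (s - t).
    The differential inequality is required only where d t <= 1, a condition
    that the bound itself guarantees: this is what permits a merely local
    Lipschitz constant. *)
Lemma gronwall_eps (d : R -> R) (S L e : R) : 0 <= L ->
  0 < e -> e * expR ((L + 1) * S) <= 1 -> d 0 <= 0 ->
  (forall t, 0 <= t -> t < S -> d t <= 1 -> forall e, 0 < e ->
    exists2 r, 0 < r & forall s, t < s -> s < t + r -> s <= S ->
      d s <= (1 + L * (s - t)) * d t + e * (s - t)) ->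
  (forall t, 0 < t -> t <= S -> forall e, 0 < e ->
    exists2 r, 0 < r & forall s, t - r < s -> s < t -> 0 <= s ->
      d t <= d s + e) ->
  forall t, 0 <= t <= S -> d t <= e * expR ((L + 1) * t).
Proof.
move=> L0 e0 eS d0 dR dL.
set g := fun t => e * expR ((L + 1) * t).
have gmono s t : s <= t -> g s <= g t.
  by move=> st; rewrite ler_pM2l// ler_expR ler_wpM2l// addr_ge0.
have ge t : 0 <= t -> e <= g t.
  move=> t0; rewrite ler_peMr ?(ltW e0)//.
  by rewrite -expR0 ler_expR mulr_ge0// addr_ge0.
move=> t0 /andP[t00 t0S]; have S0 : 0 <= S by exact: le_trans t0S.
pose A := [set t | 0 <= t <= S /\ forall s, 0 <= s <= t -> d s <= g s].
have A0 : A 0.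
  split; first by rewrite lexx.
  move=> s s0; have -> : s = 0 by apply/eqP; rewrite eq_le andbC.
  by rewrite (le_trans d0)// (le_trans (ltW e0))// ge.
have Aub : has_ubound A by exists S => t [/andP[]].
have Asup : has_sup A by split => //; exists 0.
set tau := sup A.
have tau0 : 0 <= tau by exact: ub_le_sup.
have tauS : tau <= S by apply: ge_sup => [|t [/andP[]]]//; exists 0.
have lt_tau s : 0 <= s -> s < tau -> d s <= g s.
  move=> s0 st; have [t [_ At] ts] := sup_gt Asup.1 st.
  by apply: At; rewrite s0 ltW.
have dtau : d tau <= g tau.
  move: tau0; rewrite le_eqVlt => /orP[/eqP <-|tau0].
    by have [_] := A0; apply; rewrite lexx.
  apply/ler_addgt0Pr => r r0; have [q q0 dq] := dL _ tau0 tauS _ r0.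
  pose s := Num.max 0 (tau - q / 2).
  have s0 : 0 <= s by rewrite /s le_max lexx.
  have st : s < tau by rewrite /s gt_max tau0 ltrBlDr ltrDl divr_gt0.
  apply: (le_trans (dq s _ _ _)) => //.
    by rewrite /s lt_max; apply/orP; right; lra.
  by rewrite lerD2r (le_trans (lt_tau _ s0 st))// gmono// ltW.
have Atau s : 0 <= s <= tau -> d s <= g s.
  move=> /andP[s0]; rewrite le_eqVlt => /orP[/eqP->//|]; exact: lt_tau.
suff tauE : tau = S by apply: Atau; rewrite tauE t00.
apply/eqP; rewrite eq_le tauS /= leNgt; apply/negP => tau_lt.
have dt1 : d tau <= 1.
  by apply: (le_trans dtau); apply: le_trans eS; exact: gmono.
have [r r0 dr] := dR _ tau0 tau_lt dt1 _ e0.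
have step s : tau < s -> s < tau + r -> s <= S -> d s <= g s.
  move=> ts sr sS; apply: (le_trans (dr s ts sr sS)).
  have sg : g s = g tau * expR ((L + 1) * (s - tau)).
    by rewrite /g -mulrA -expRD; congr (_ * expR _); ring.
  have st0 : 0 <= s - tau by rewrite subr_ge0 ltW.
  apply: (@le_trans _ _ (g tau * (1 + (L + 1) * (s - tau)))); last first.
    by rewrite sg ler_wpM2l ?expR_ge1Dx// (le_trans (ltW e0))// ge.
  have h1 : (1 + L * (s - tau)) * d tau <= (1 + L * (s - tau)) * g tau.
    by rewrite ler_wpM2l// addr_ge0// mulr_ge0.
  have h2 : e * (s - tau) <= g tau * (s - tau) by rewrite ler_wpM2r// ge.
  apply: (le_trans (lerD h1 h2)).
  by rewrite le_eqVlt; apply/orP; left; apply/eqP; ring.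
pose s := Num.min S (tau + r / 2).
have ts : tau < s by rewrite /s lt_min tau_lt ltrDl divr_gt0.
have sS : s <= S by rewrite /s ge_min lexx.
have sr : s < tau + r by rewrite /s gt_min; apply/orP; right; lra.
suff : s <= tau by rewrite leNgt ts.
apply: ub_le_sup => //; split; first by rewrite sS (le_trans tau0)// ltW.
move=> q /andP[q0 qs]; have [qt|qt] := leP q tau; first by apply: Atau; rewrite q0.
by apply: step => //; [exact: le_lt_trans sr|exact: le_trans sS].
Qed.

Lemma gronwall_zero (d : R -> R) (S L : R) : 0 <= L -> d 0 <= 0 ->
  (forall t, 0 <= t -> t < S -> d t <= 1 -> forall e, 0 < e ->
    exists2 r, 0 < r & forall s, t < s -> s < t + r -> s <= S ->
      d s <= (1 + L * (s - t)) * d t + e * (s - t)) ->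
  (forall t, 0 < t -> t <= S -> forall e, 0 < e ->
    exists2 r, 0 < r & forall s, t - r < s -> s < t -> 0 <= s ->
      d t <= d s + e) ->
  forall t, 0 <= t <= S -> d t <= 0.
Proof.
move=> L0 d0 dR dL t /[dup] t0S /andP[t0 tS].
set c := expR ((L + 1) * S); have c0 : 0 < c by exact: expR_gt0.
apply/ler_addgt0Pr => e e0; rewrite add0r.
pose e1 := Num.min 1 e / c.
have e10 : 0 < e1 by rewrite divr_gt0// lt_min ltr01.
have e1c : e1 * c = Num.min 1 e by rewrite /e1 divfK// gt_eqF.
have e1S : e1 * c <= 1 by rewrite e1c ge_min lexx.
apply: (le_trans (gronwall_eps L0 e10 e1S d0 dR dL t0S)).
apply: (@le_trans _ _ (e1 * c)).
  by rewrite ler_pM2l// ler_expR ler_wpM2l// addr_ge0.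
by rewrite e1c ge_min lexx orbT.
Qed.

End Gronwall.

(** * The nonlocal operator *)

(** The kernels of the equation on the line are k x y = K (x - y) and
    g x y = G (x - y).  Only the following properties matter, which leaves the
    operator free of translation invariance. *)
Record jump_kernels d (T : measurableType d) (R : realType)
    (mu : {sigma_finite_measure set T -> \bar R}) (k g : T -> T -> R) (C : R)
    : Prop := JumpKernels {
  jump_measurable : measurable_fun setT (fun p : T * T => k p.1 p.2);
  drift_measurable : measurable_fun setT (fun p : T * T => g p.1 p.2);
  jump_ge0 : forall x y, 0 <= k x y;
  jump_sym : forall x y, k x y = k y x;
  jump_mass : forall x, (\int[mu]_y (k x y)%:E = 1)%E;
  drift_anti : forall x y, g x y = - g y x;
  drift_mass : forall x, \int[mu]_y g x y = 0;
  drift_le : forall x y, `|g x y| <= C * k x y;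
  drift_ratio_ge0 : 0 <= C }.

Section NonlocalOperator.
Context d (T : measurableType d) (R : realType).
Variable mu : {sigma_finite_measure set T -> \bar R}.
Variables (k g : T -> T -> R) (C : R).
Hypothesis kg : jump_kernels mu k g C.

Let mk : measurable_fun setT (fun p : T * T => k p.1 p.2).
Proof. exact: jump_measurable kg. Qed.
Let mg : measurable_fun setT (fun p : T * T => g p.1 p.2).
Proof. exact: drift_measurable kg. Qed.
Let k_ge0 : forall x y, 0 <= k x y. Proof. exact: jump_ge0 kg. Qed.
Let k_sym : forall x y, k x y = k y x. Proof. exact: jump_sym kg. Qed.
Let k_int : forall x, (\int[mu]_y (k x y)%:E = 1)%E.
Proof. exact: jump_mass kg. Qed.
Let g_anti : forall x y, g x y = - g y x. Proof. exact: drift_anti kg. Qed.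
Let g_int : forall x, \int[mu]_y g x y = 0. Proof. exact: drift_mass kg. Qed.
Let gk : forall x y, `|g x y| <= C * k x y. Proof. exact: drift_le kg. Qed.

Definition nonlocal_op (v : T -> R) (x : T) : R :=
  \int[mu]_y (k x y * (v y - v x)) +
  \int[mu]_y (g x y * ((v y + v x) / 2) ^+ 2).
Local Notation F := nonlocal_op.

Let mk1 x : measurable_fun setT (k x).
Proof. exact: (measurableT_comp mk (measurable_pair1 x)). Qed.

Let mg1 x : measurable_fun setT (g x).
Proof. exact: (measurableT_comp mg (measurable_pair1 x)). Qed.


Let k_integrable x : mu.-integrable setT (EFin \o k x).
Proof.
apply/integrableP; split; first exact/measurable_EFinP.
under eq_integral do rewrite /= ger0_norm//.
by rewrite k_int ltry.
Qed.

Lemma integrable_le_kernel x (p : T -> R) c : measurable_fun setT p ->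
  (forall y, `|p y| <= c * k x y) -> mu.-integrable setT (EFin \o p).
Proof.
move=> mp pk; apply: (@le_integrable _ _ _ mu setT measurableT _
  (fun y => c%:E * (k x y)%:E)%E) => //.
- exact/measurable_EFinP.
- move=> y _ /=; rewrite lee_fin; apply: (le_trans (pk y)).
  exact: ler_norm.
- exact: (integrableZl measurableT c (k_integrable x)).
Qed.

Lemma Rintegral_kernel x c : \int[mu]_y (c * k x y) = c.
Proof.
rewrite (@RintegralZl _ _ _ mu setT (k x) c measurableT (k_integrable x)).
by rewrite /Rintegral k_int /= mulr1.
Qed.

Lemma integrable_kmul x (f : T -> R) A : measurable_fun setT f ->
  (forall y, `|f y| <= A) -> mu.-integrable setT (EFin \o (fun y => k x y * f y)).
Proof.
move=> mf fA; apply: (@integrable_le_kernel x _ A).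
  exact: measurable_funM.
by move=> y; rewrite normrM ger0_norm// mulrC ler_wpM2r.
Qed.

Lemma integrable_gmul x (f : T -> R) A : measurable_fun setT f ->
  (forall y, `|f y| <= A) -> mu.-integrable setT (EFin \o (fun y => g x y * f y)).
Proof.
move=> mf fA; apply: (@integrable_le_kernel x _ (C * A)).
  exact: measurable_funM.
by move=> y; rewrite normrM mulrAC ler_pM.
Qed.


Let integrable_jump x (v : T -> R) (A : R) : measurable_fun setT v ->
  (forall y, `|v y| <= A) ->
  mu.-integrable setT (EFin \o (fun y => k x y * (v y - v x))).
Proof.
move=> mv vA; apply: (@integrable_kmul _ _ (A + A)).
  exact: measurable_funB.
by move=> y; rewrite (le_trans (ler_normB _ _))// lerD.
Qed.

Let integrable_drift x (v : T -> R) (A : R) : measurable_fun setT v ->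
  (forall y, `|v y| <= A) ->
  mu.-integrable setT (EFin \o (fun y => g x y * ((v y + v x) / 2) ^+ 2)).
Proof.
move=> mv vA; apply: (@integrable_gmul _ _ (A ^+ 2)).
  apply: measurable_funX; apply: measurable_funM => //.
  exact: measurable_funD.
move=> y; rewrite normrX lerXn2r// ?nnegrE//.
  exact: le_trans (vA x).
rewrite ler_norml; have := vA y; have := vA x; rewrite !ler_norml.
by move=> /andP[? ?] /andP[? ?]; apply/andP; split; lra.
Qed.

Let integrable_pairing x (v : T -> R) (A : R) : measurable_fun setT v ->
  (forall y, `|v y| <= A) ->
  mu.-integrable setT (EFin \o (fun y => k x y * (v y - v x) +
                                 g x y * ((v y + v x) / 2) ^+ 2)).
Proof.
move=> mv vA; apply: (@eq_integrable _ _ _ mu setT measurableT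
  (fun y => (k x y * (v y - v x))%R%:E +
            (g x y * ((v y + v x) / 2) ^+ 2)%R%:E)%E) => //.
apply: integrableD => //; [exact: integrable_jump vA|].
exact: integrable_drift vA.
Qed.

Lemma nonlocal_opE (v : T -> R) (A : R) x : measurable_fun setT v ->
  (forall y, `|v y| <= A) ->
  F v x = \int[mu]_y (k x y * (v y - v x) +
                      g x y * ((v y + v x) / 2) ^+ 2).
Proof.
move=> mv vA; rewrite RintegralD//; [exact: integrable_jump vA|].
exact: integrable_drift vA.
Qed.

Let s (v w : T -> R) x y := (v y + v x + (w y + w x)) / 4.

Let integrable_diff x (v w : T -> R) (A : R) : measurable_fun setT v ->
  measurable_fun setT w ->
  (forall y, `|v y| <= A) -> (forall y, `|w y| <= A) ->
  mu.-integrable setT (EFin \o (fun y =>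
    (k x y + g x y * s v w x y) * (w y - v y) +
    (- k x y + g x y * s v w x y) * (w x - v x))).
Proof.
move=> mv mw vA wA; apply: (@eq_integrable _ _ _ mu setT measurableT
   (fun y => (k x y * (w y - w x) + g x y * ((w y + w x) / 2) ^+ 2)%R%:E -
             (k x y * (v y - v x) + g x y * ((v y + v x) / 2) ^+ 2)%R%:E)%E).
  by move=> y _ /=; rewrite -EFinB; congr EFin; rewrite /s; field.
by apply: integrableB => //; exact: integrable_pairing.
Qed.

(** The squares are factored as a difference of squares, which exhibits F as
    linear in the difference of its arguments, with coefficients controlled by
    the kernel k. *)
Lemma nonlocal_opB (v w : T -> R) (A : R) x : measurable_fun setT v ->
  measurable_fun setT w ->
  (forall y, `|v y| <= A) -> (forall y, `|w y| <= A) ->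
  F w x - F v x = \int[mu]_y (
    (k x y + g x y * s v w x y) * (w y - v y) +
    (- k x y + g x y * s v w x y) * (w x - v x)).
Proof.
move=> mv mw vA wA; rewrite !(nonlocal_opE (A := A))// -RintegralB//.
- by apply: eq_Rintegral => y _; rewrite /s; field.
- exact: integrable_pairing wA.
- exact: integrable_pairing vA.
Qed.

Let gs_le (v w : T -> R) (A : R) x y :
  (forall y, `|v y| <= A) -> (forall y, `|w y| <= A) ->
  `|g x y * s v w x y| <= C * A * k x y.
Proof.
move=> vA wA; rewrite normrM mulrAC ler_pM//.
rewrite /s ler_norml.
have := vA y; have := vA x; have := wA x; have := wA y; rewrite !ler_norml.
by do 4 move=> /andP[? ?]; apply/andP; split; lra.
Qed.

Lemma nonlocal_op_lipschitz (v w : T -> R) (A : R) x : measurable_fun setT v ->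
  measurable_fun setT w ->
  (forall y, `|v y| <= A) -> (forall y, `|w y| <= A) ->
  `|F w x - F v x| <=
  (1 + C * A) * \int[mu]_y (k x y * (`|w y - v y| + `|w x - v x|)).
Proof.
move=> mv mw vA wA; rewrite (nonlocal_opB _ mv mw vA wA).
have mD : measurable_fun setT (fun y => `|w y - v y| + `|w x - v x|).
  apply: measurable_funD => //; apply: measurableT_comp => //.
  exact: measurable_funB.
have iD : mu.-integrable setT
    (EFin \o (fun y => k x y * (`|w y - v y| + `|w x - v x|))).
  apply: (@integrable_kmul _ _ (4 * A)) => // y.
  rewrite ger0_norm ?addr_ge0//.
  have := ler_normB (w y) (v y); have := ler_normB (w x) (v x).
  have := vA y; have := vA x; have := wA x; have := wA y; lra.
rewrite -RintegralZl//; apply: (le_trans (le_normr_Rintegral _ _)) => //.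
  exact: integrable_diff vA wA.
apply: le_Rintegral => //.
- exact/integrable_norm/(integrable_diff x mv mw vA wA).
- have := integrableZl measurableT (1 + C * A) iD.
  by apply: eq_integrable.
- move=> y _; apply: (le_trans (ler_normD _ _)); rewrite !normrM.
  have := gs_le x y vA wA; set G := g x y * _ => GA.
  have h1 : `|k x y + G| <= (1 + C * A) * k x y.
    by apply: (le_trans (ler_normD _ _)); rewrite ger0_norm// mulrDl mul1r lerD2l.
  have h2 : `|- k x y + G| <= (1 + C * A) * k x y.
    by apply: (le_trans (ler_normD _ _));
       rewrite normrN ger0_norm// mulrDl mul1r lerD2l.
  by rewrite mulrA mulrDr lerD// ler_wpM2r.
Qed.

Lemma nonlocal_op_lipschitz_sup (v w : T -> R) (A e : R) x : measurable_fun setT v ->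
  measurable_fun setT w ->
  (forall y, `|v y| <= A) -> (forall y, `|w y| <= A) -> 0 <= C * A ->
  (forall y, `|w y - v y| <= e) ->
  `|F w x - F v x| <= 2 * (1 + C * A) * e.
Proof.
move=> mv mw vA wA CA vwe.
apply: (le_trans (nonlocal_op_lipschitz x mv mw vA wA)).
rewrite (mulrC 2) -mulrA ler_wpM2l ?addr_ge0//.
rewrite -[leRHS](Rintegral_kernel x); apply: le_Rintegral => //.
- apply: (@integrable_kmul _ _ (2 * e)) => //.
    apply: measurable_funD => //; apply: measurableT_comp => //.
    exact: measurable_funB.
  move=> y; rewrite ger0_norm ?addr_ge0//.
  by have := vwe x; have := vwe y; lra.
- by have := integrableZl measurableT (2 * e) (k_integrable x);
    apply: eq_integrable.
- move=> y _; rewrite mulrC ler_wpM2r//.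
  by have := vwe x; have := vwe y; lra.
Qed.

(** The coefficients of nonlocal_opB satisfy k + g s >= 0 and
    - k + g s >= - 2 k as soon as C * A <= 1, so the step cannot lose more
    than 2 h <= 1 times the pointwise difference w x - v x. *)
Lemma euler_step_mono (v w : T -> R) (A h : R) : measurable_fun setT v ->
  measurable_fun setT w ->
  (forall y, `|v y| <= A) -> (forall y, `|w y| <= A) -> C * A <= 1 ->
  0 <= h <= 1 / 2 -> (forall x, v x <= w x) ->
  forall x, v x + h * F v x <= w x + h * F w x.
Proof.
move=> mv mw vA wA CA /andP[h0 h1] vw x.
suff : - 2 * (w x - v x) <= F w x - F v x.
  by have := vw x; move: (F w x) (F v x) (w x) (v x) => a b c e; nra.
rewrite (nonlocal_opB _ mv mw vA wA) -[leLHS](Rintegral_kernel x).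
apply: le_Rintegral => //.
- by have := integrableZl measurableT (- 2 * (w x - v x)) (k_integrable x);
    apply: eq_integrable.
- exact: integrable_diff vA wA.
- move=> y _; have := gs_le x y vA wA; set G := g x y * _ => GA.
  have : `|G| <= k x y.
    by apply: (le_trans GA); rewrite ler_piMl.
  rewrite ler_norml => /andP[G1 G2].
  have := vw x; have := vw y; rewrite -!(subr_ge0 (v _)).
  move: (w y - v y) (w x - v x) (k_ge0 x y) => a b ? a0 b0; nra.
Qed.

Lemma nonlocal_op_cst c : F (cst c) = cst 0.
Proof.
apply/funext => x; rewrite /nonlocal_op /=.
under eq_Rintegral do rewrite subrr mulr0.
rewrite Rintegral_cst// mul0r add0r.
rewrite RintegralZr//; first by rewrite g_int mul0r.
by apply: (@integrable_le_kernel x _ C).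
Qed.

(** Comparison with the constants a and b, which the step leaves unchanged. *)
Lemma euler_step_bounds (v : T -> R) (A a b h : R) : measurable_fun setT v ->
  (forall y, `|v y| <= A) -> C * A <= 1 -> 0 <= h <= 1 / 2 ->
  `|a| <= A -> `|b| <= A -> (forall y, a <= v y <= b) ->
  forall x, a <= v x + h * F v x <= b.
Proof.
move=> mv vA CA h01 aA bA avb x; apply/andP; split.
  have av y : a <= v y by case/andP: (avb y).
  have := euler_step_mono (measurable_cst a) mv (fun=> aA) vA CA h01 av x.
  by rewrite nonlocal_op_cst /= mulr0 addr0.
have vb y : v y <= b by case/andP: (avb y).
have := euler_step_mono mv (measurable_cst b) vA (fun=> bA) CA h01 vb x.
by rewrite nonlocal_op_cst /= mulr0 addr0.
Qed.

Let measurable_pairing (v : T -> R) : measurable_fun setT v ->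
  measurable_fun setT (fun p : T * T => k p.1 p.2 * (v p.2 - v p.1) +
     g p.1 p.2 * ((v p.2 + v p.1) / 2) ^+ 2).
Proof.
move=> mv.
have mv1 : measurable_fun setT (fun p : T * T => v p.1).
  exact: measurableT_comp.
have mv2 : measurable_fun setT (fun p : T * T => v p.2).
  exact: measurableT_comp.
apply: measurable_funD; apply: measurable_funM => //.
  exact: measurable_funB.
apply: measurable_funX; apply: measurable_funM => //.
exact: measurable_funD.
Qed.

Lemma measurable_nonlocal_op (v : T -> R) (A : R) : measurable_fun setT v ->
  (forall y, `|v y| <= A) -> measurable_fun setT (F v).
Proof.
move=> mv vA; have := measurable_Rintegral_section mu (measurable_pairing mv).
by apply: eq_measurable_fun => x _ /=; rewrite (nonlocal_opE _ mv vA).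
Qed.

(** By symmetry of k, integrating k in either variable gives 1, so that Tonelli
    makes both terms contribute the integral of f. *)
Lemma integral_kernel_sum (f : T -> R) : measurable_fun setT f ->
  (forall y, 0 <= f y) ->
  (\int[mu]_x \int[mu]_y (k x y * (f y + f x))%:E =
   \int[mu]_y (f y)%:E + \int[mu]_y (f y)%:E)%E.
Proof.
move=> mf f0.
have mkf : measurable_fun setT (fun p : T * T => (k p.1 p.2 * f p.2)%:E).
  apply/measurable_EFinP; apply: measurable_funM => //.
  exact: measurableT_comp.
have E1 x : (\int[mu]_y (k x y * (f y + f x))%:E =
    \int[mu]_y (k x y * f y)%:E + (f x)%:E)%E.
  under eq_integral do rewrite mulrDr EFinD.
  rewrite ge0_integralD//.
  - congr (_ + _)%E; under eq_integral do rewrite mulrC EFinM.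
    rewrite ge0_integralZl//.
    + by rewrite k_int mule1.
    + exact/measurable_EFinP.
    + by move=> y _; rewrite lee_fin.
    + by rewrite lee_fin.
  - by move=> y _; rewrite lee_fin mulr_ge0.
  - by apply/measurable_EFinP/measurable_funM.
  - by move=> y _; rewrite lee_fin mulr_ge0.
  - by apply/measurable_EFinP/measurable_funM.
under eq_integral do rewrite E1.
rewrite ge0_integralD//; first last.
- exact/measurable_EFinP.
- by move=> y _; rewrite lee_fin.
- apply: (measurable_fun_fubini_tonelli_F (m2 := mu) _ mkf) => p.
  by rewrite lee_fin mulr_ge0.
- by move=> x _; apply: integral_ge0 => y _; rewrite lee_fin mulr_ge0.
congr (_ + _)%E.
rewrite (fubini_tonelli (m1 := mu) (m2 := mu) _ mkf)/=; last first.
  by move=> p; rewrite lee_fin mulr_ge0.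
apply: eq_integral => y _.
under eq_integral do rewrite mulrC EFinM k_sym.
rewrite ge0_integralZl//.
+ by rewrite k_int mule1.
+ exact/measurable_EFinP.
+ by move=> x _; rewrite lee_fin.
+ by rewrite lee_fin.
Qed.

Lemma nonlocal_op_lipschitz_L1 (v w : T -> R) (A : R) : measurable_fun setT v ->
  measurable_fun setT w ->
  (forall y, `|v y| <= A) -> (forall y, `|w y| <= A) -> 0 <= C * A ->
  (\int[mu]_x (`|F w x - F v x|)%:E <=
   (2 * (1 + C * A))%:E * \int[mu]_x (`|w x - v x|)%:E)%E.
Proof.
move=> mv mw vA wA CA.
have mD : measurable_fun setT (fun y => `|w y - v y|).
  by apply: measurableT_comp => //; exact: measurable_funB.
have D0 y : 0 <= `|w y - v y| by [].
have mkD : measurable_fun setT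
    (fun p : T * T => (k p.1 p.2 * (`|w p.2 - v p.2| + `|w p.1 - v p.1|))%:E).
  apply/measurable_EFinP; apply: measurable_funM => //.
  by apply: measurable_funD; apply: (measurableT_comp mD).
have kD0 x y : (0 <= (k x y * (`|w y - v y| + `|w x - v x|))%:E)%E.
  by rewrite lee_fin mulr_ge0// addr_ge0.
have mS : measurable_fun setT
    (fun x => \int[mu]_y (k x y * (`|w y - v y| + `|w x - v x|))%:E)%E.
  by apply: (measurable_fun_fubini_tonelli_F (m2 := mu) _ mkD).
apply: (@le_trans _ _ (\int[mu]_x ((1 + C * A)%:E *
   \int[mu]_y (k x y * (`|w y - v y| + `|w x - v x|))%:E))%E).
  apply: ge0_le_integral => //.
  - apply/measurable_EFinP; apply: measurableT_comp => //.
    by apply: measurable_funB; [exact: measurable_nonlocal_op wA|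
                                exact: measurable_nonlocal_op vA].
  - exact: measurable_funeM.
  - move=> x _; have := nonlocal_op_lipschitz x mv mw vA wA.
    rewrite -lee_fin => /le_trans; apply.
    rewrite EFinM lee_wpmul2l ?lee_fin ?addr_ge0//.
    rewrite /Rintegral fineK// integrable_fin_num//.
    apply: (@integrable_kmul _ _ (4 * A)) => //.
      exact: measurable_funD.
    move=> y; rewrite ger0_norm ?addr_ge0//.
    have := ler_normB (w y) (v y); have := ler_normB (w x) (v x).
    have := vA y; have := vA x; have := wA x; have := wA y; lra.
rewrite ge0_integralZl//; last 2 first.
- by move=> x _; apply: integral_ge0.
- by rewrite lee_fin addr_ge0.
by rewrite integral_kernel_sum// -mule2n -mule_natl muleA -EFinM mulrC.
Qed.

(** The integrand of nonlocal_opE is antisymmetric in (x, y); the bound pA makes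
    it integrable on the product, so Fubini applies. *)
Lemma nonlocal_op_mass (v : T -> R) (A : R) : mu.-integrable setT (EFin \o v) ->
  (forall y, `|v y| <= A) -> 0 <= C * A ->
  (\int[mu]_x (F v x)%:E = 0)%E.
Proof.
move=> iv vA CA.
have mv : measurable_fun setT v by apply/measurable_EFinP/(measurable_int mu).
have mnv : measurable_fun setT (fun y => `|v y|) by exact: measurableT_comp.
pose p x y := k x y * (v y - v x) + g x y * ((v y + v x) / 2) ^+ 2.
have pA x y : `|p x y| <= (1 + C * A) * (k x y * (`|v y| + `|v x|)).
  rewrite /p; apply: (le_trans (ler_normD _ _)).
  rewrite [leRHS]mulrDl mul1r lerD//.
    by rewrite normrM ger0_norm// ler_wpM2l// ler_normB.
  rewrite normrM [leRHS](_ : _ = C * k x y * (A * (`|v y| + `|v x|))).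
    rewrite ler_pM// expr2 normrM ler_pM//.
    - rewrite ler_norml; have := vA y; have := vA x; rewrite !ler_norml.
      by move=> /andP[? ?] /andP[? ?]; apply/andP; split; lra.
    - rewrite normrM; have := ler_normD (v y) (v x).
      have := normr_ge0 (v x); have := normr_ge0 (v y).
      by rewrite (@ger0_norm _ (2^-1))//; lra.
  by rewrite !mulrA; congr (_ * _); rewrite mulrAC.
have mp : measurable_fun setT (fun q : T * T => (p q.1 q.2)%:E).
  by apply/measurable_EFinP; exact: (measurable_pairing mv).
have ip : (mu \x mu)%E.-integrable setT (fun q : T * T => (p q.1 q.2)%:E).
  apply/(integrable12ltyP _ _ mp).
  have mkD : measurable_fun setT
      (fun p : T * T => (k p.1 p.2 * (`|v p.2| + `|v p.1|))%:E).
    apply/measurable_EFinP; apply: measurable_funM => //.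
    by apply: measurable_funD; apply: (measurableT_comp mnv).
  apply: (@le_lt_trans _ _ (\int[mu]_x ((1 + C * A)%:E *
      \int[mu]_y (k x y * (`|v y| + `|v x|))%:E))%E).
    apply: ge0_le_integral => //.
    - by move=> x _; apply: integral_ge0.
    - apply: (measurable_fun_fubini_tonelli_F (m2 := mu)
        (fun q : T * T => `|(p q.1 q.2)%:E|%E)) => //.
      exact: measurableT_comp.
    - apply: measurable_funeM.
      apply: (measurable_fun_fubini_tonelli_F (m2 := mu) _ mkD) => q.
      by rewrite lee_fin mulr_ge0// addr_ge0.
    - move=> x _; rewrite -ge0_integralZl//=; last 3 first.
      + apply/measurable_EFinP; apply: measurable_funM => //.
        exact: measurable_funD.
      + by move=> y _; rewrite lee_fin mulr_ge0// addr_ge0.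
      + by rewrite lee_fin addr_ge0.
      apply: ge0_le_integral => //.
      - have mpx : measurable_fun setT (fun y => (p x y)%:E).
          exact: (measurableT_comp mp (measurable_pair1 x)).
        by apply/measurable_EFinP; apply: measurableT_comp => //; exact/measurable_EFinP.
      - apply: measurable_funeM; apply/measurable_EFinP.
        by apply: measurable_funM => //; exact: measurable_funD.
      - by move=> y _; rewrite -EFinM lee_fin.
  rewrite ge0_integralZl//; last 3 first.
  - apply: (measurable_fun_fubini_tonelli_F (m2 := mu) _ mkD) => q.
    by rewrite lee_fin mulr_ge0// addr_ge0.
  - by move=> x _; apply: integral_ge0 => y _; rewrite lee_fin mulr_ge0// addr_ge0.
  - by rewrite lee_fin addr_ge0.
  rewrite integral_kernel_sum//.
  have /integrableP[_ iv'] := iv.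
  by rewrite lte_mul_pinfty// ?lee_fin ?addr_ge0// lte_add_pinfty.
have E x : (F v x)%:E = (\int[mu]_y (p x y)%:E)%E.
  rewrite (nonlocal_opE x mv vA) /Rintegral fineK// integrable_fin_num//.
  exact: integrable_pairing vA.
under eq_integral do rewrite E.
apply: (integral_antisymmetric (p := p)) => // x y.
by rewrite /p k_sym g_anti (addrC (v x)); ring.
Qed.

Lemma integrable_nonlocal_op (v : T -> R) (A : R) :
  mu.-integrable setT (EFin \o v) -> (forall y, `|v y| <= A) -> 0 <= C * A ->
  0 <= A -> mu.-integrable setT (EFin \o F v).
Proof.
move=> iv vA CA A0.
have mv : measurable_fun setT v by apply/measurable_EFinP/(measurable_int mu).
apply/integrableP; split.
  by apply/measurable_EFinP; exact: measurable_nonlocal_op vA.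
have c0 : measurable_fun setT (cst 0 : T -> R) by [].
have zA (y : T) : `|cst (0 : R) y| <= A by rewrite normr0.
have := nonlocal_op_lipschitz_L1 c0 mv zA vA CA.
rewrite nonlocal_op_cst; under eq_integral do rewrite subr0.
move/le_lt_trans; apply.
under eq_integral do rewrite subr0.
have /integrableP[_ iv'] := iv.
by rewrite lte_mul_pinfty// lee_fin mulr_ge0// addr_ge0.
Qed.

Lemma euler_step_mass (v : T -> R) (A h : R) :
  mu.-integrable setT (EFin \o v) -> (forall y, `|v y| <= A) -> 0 <= C * A ->
  0 <= A ->
  mu.-integrable setT (fun x => (v x + h * F v x)%:E) /\
  (\int[mu]_x (v x + h * F v x)%:E = \int[mu]_x (v x)%:E)%E.
Proof.
move=> iv vA CA A0.
have ihF : mu.-integrable setT (fun x => (h%:E * (F v x)%:E)%E).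
  by apply: integrableZl => //; exact: integrable_nonlocal_op vA CA A0.
split.
  apply: (@eq_integrable _ _ _ mu setT measurableT
    (fun x => (v x)%:E + h%:E * (F v x)%:E)%E) => //.
  exact: integrableD.
under eq_integral do rewrite EFinD EFinM.
rewrite integralD// integralZl//; last exact: integrable_nonlocal_op vA CA A0.
by rewrite (nonlocal_op_mass iv vA CA) mule0 adde0.
Qed.

(** The Crandall-Tartar argument.  The positive part p and the opposite n of
    the negative part of v bracket it, hence so do their Euler steps, which
    keep the signs of p and n.  The modulus of the step of v is then at most the
    difference of the steps of p and n, whose integral is that of
    p - n = |v| by conservation of mass. *)
Lemma euler_step_L1 (v : T -> R) (A h : R) : mu.-integrable setT (EFin \o v) ->
  (forall y, `|v y| <= A) -> 0 <= A -> 0 <= C * A <= 1 -> 0 <= h <= 1 / 2 ->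
  (\int[mu]_x (`|v x + h * F v x|)%:E <= \int[mu]_x (`|v x|)%:E)%E.
Proof.
move=> iv vA A0 /andP[CA CA1] h01.
have mv : measurable_fun setT v by apply/measurable_EFinP/(measurable_int mu).
have mnv : measurable_fun setT (fun y => `|v y|) by exact: measurableT_comp.
have inv : mu.-integrable setT (fun x => (`|v x|)%:E) by exact: integrable_norm.
pose p x := (`|v x| + v x) / 2; pose n x := (v x - `|v x|) / 2.
have mp : measurable_fun setT p.
  by apply: measurable_funM => //; exact: measurable_funD.
have mn : measurable_fun setT n.
  by apply: measurable_funM => //; exact: measurable_funB.
have np x : [/\ n x <= v x, v x <= p x, n x <= 0 & 0 <= p x].
  have := ler_norm (v x); have := lerNnormlW (lexx `|v x|).
  by rewrite /n /p; split; lra.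
have pb x : `|p x| <= `|v x|.
  by have [? ? ? ?] := np x; rewrite ger0_norm//; rewrite /p; have := ler_norm (v x); lra.
have nb x : `|n x| <= `|v x|.
  have [? ? ? ?] := np x; rewrite ler0_norm//; rewrite /n.
  by have := lerNnormlW (lexx `|v x|); lra.
have pA x : `|p x| <= A by exact: le_trans (vA x).
have nA x : `|n x| <= A by exact: le_trans (vA x).
have ip : mu.-integrable setT (EFin \o p).
  apply: (le_integrable measurableT _ _ inv); first exact/measurable_EFinP.
  by move=> x _ /=; rewrite lee_fin normr_id.
have in_ : mu.-integrable setT (EFin \o n).
  apply: (le_integrable measurableT _ _ inv); first exact/measurable_EFinP.
  by move=> x _ /=; rewrite lee_fin normr_id.
have [iP EP] := euler_step_mass h ip pA CA A0.
have [iN EN] := euler_step_mass h in_ nA CA A0.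
have a0 : `|0 : R| <= A by rewrite normr0.
have aA : `|A| <= A by rewrite ger0_norm.
have aN : `|- A| <= A by rewrite normrN ger0_norm.
have P0 x : 0 <= p x + h * F p x.
  suff /andP[//] : 0 <= p x + h * F p x <= A.
  apply: (euler_step_bounds mp pA CA1 h01 a0 aA) => y.
  by have [_ _ _ ->] := np y; rewrite (le_trans (ler_norm _)).
have N0 x : n x + h * F n x <= 0.
  suff /andP[//] : - A <= n x + h * F n x <= 0.
  apply: (euler_step_bounds mn nA CA1 h01 aN a0) => y.
  by have [_ _ -> _] := np y; rewrite andbT; have := nA y; rewrite ler_norml => /andP[].
have VP := euler_step_mono mv mp vA pA CA1 h01 (fun x => let: And4 _ h _ _ := np x in h).
have NV := euler_step_mono mn mv nA vA CA1 h01 (fun x => let: And4 h _ _ _ := np x in h).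
have mF : measurable_fun setT (F v) by exact: measurable_nonlocal_op vA.
apply: (@le_trans _ _ (\int[mu]_x
    ((p x + h * F p x)%:E - (n x + h * F n x)%:E))%E).
  apply: ge0_le_integral => //.
  - apply/measurable_EFinP; apply: measurableT_comp => //.
    by apply: measurable_funD => //; exact: measurable_funM.
  - by apply: (measurable_int mu); exact: integrableB.
  - move=> x _; rewrite -EFinB lee_fin ler_norml.
    by have := P0 x; have := N0 x; have := VP x; have := NV x;
      move=> *; apply/andP; split; lra.
rewrite integralB// EP EN -integralB//.
apply: ge0_le_integral => //.
- by move=> x _; have [_ _ ? ?] := np x; rewrite -EFinB lee_fin; lra.
- by apply: (measurable_int mu); exact: integrableB.
- exact: (measurable_int mu).
- by move=> x _; rewrite -EFinB lee_fin /p /n; lra.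
Qed.

(** F v x depends on the value of v at the point x, hence the last hypothesis in
    addition to the almost everywhere equality. *)
Lemma nonlocal_op_ae_eq (v w : T -> R) x : measurable_fun setT v ->
  measurable_fun setT w -> v = w %[ae mu] -> v x = w x -> F v x = F w x.
Proof.
move=> mv mw vw vwx; rewrite /nonlocal_op /Rintegral vwx.
congr (fine _ + fine _); apply: ae_eq_integral => //.
- by apply/measurable_EFinP; apply: measurable_funM => //; exact: measurable_funB.
- by apply/measurable_EFinP; apply: measurable_funM => //; exact: measurable_funB.
- by apply: filterS vw => y /= -> //.
- apply/measurable_EFinP; apply: measurable_funM => //.
  by apply: measurable_funX; apply: measurable_funM => //; exact: measurable_funD.
- apply/measurable_EFinP; apply: measurable_funM => //.
  by apply: measurable_funX; apply: measurable_funM => //; exact: measurable_funD.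
- by apply: filterS vw => y /= -> //.
Qed.

End NonlocalOperator.

(** * Euler iterates of the nonlocal operator *)

Section NonlocalEuler.
Context d (T : measurableType d) (R : realType).
Variable mu : {sigma_finite_measure set T -> \bar R}.
Variables (k g : T -> T -> R) (C : R).
Hypothesis kg : jump_kernels mu k g C.
Let C_ge0 : 0 <= C. Proof. exact: drift_ratio_ge0 kg. Qed.
Local Notation F := (nonlocal_op mu k g).
Local Notation E phi n := (euler F phi (mesh n)).
Local Notation h := (@mesh R).
Local Notation lip M := (2 * (1 + C * M)).

Lemma norm_le_nonlocal_opB (v w : T -> R) (M e : R) :
  norm_le mu v M -> norm_le mu w M ->
  norm_le mu (fun x => w x - v x) e ->
  norm_le mu (fun x => F w x - F v x) (lip M * e).
Proof.
move=> vM wM we; have CM : 0 <= C * M by rewrite mulr_ge0 ?(norm_le_ge0 vM).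
have [mv vA _] := vM; have [mw wA _] := wM; have [mD De ID] := we; split.
- by apply: measurable_funB; [exact: (measurable_nonlocal_op kg mw wA)|
    exact: (measurable_nonlocal_op kg mv vA)].
- by move=> x; exact: (nonlocal_op_lipschitz_sup kg).
- apply: le_trans (nonlocal_op_lipschitz_L1 kg mv mw vA wA CM) _ => //.
  by rewrite [leRHS]EFinM lee_wpmul2l// lee_fin mulr_ge0// addr_ge0.
Qed.

Lemma norm_le_nonlocal_op (v : T -> R) (M : R) :
  norm_le mu v M -> norm_le mu (F v) (lip M * M).
Proof.
move=> vM; have M0 := norm_le_ge0 vM.
have c0 : norm_le mu (cst 0 : T -> R) M by exact: norm_leW M0 (norm_le0 mu).
have vc : norm_le mu (fun x => v x - cst 0 x) M.
  by apply: eq_norm_le vM => x; rewrite subr0.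
apply: eq_norm_le (norm_le_nonlocal_opB c0 vM vc) => x.
by rewrite (nonlocal_op_cst kg) //= subr0.
Qed.

(** For v known only almost everywhere: truncating v - u at height e produces a
    function bounded everywhere, equal to v almost everywhere. *)
Lemma nonlocal_op_ae_lipschitz (u v : T -> R) (M e : R) :
  measurable_fun setT u -> (forall x, `|u x| <= M) -> measurable_fun setT v ->
  0 <= e -> {ae mu, forall x, `|v x - u x| <= e} ->
  {ae mu, forall x, `|F v x - F u x| <= lip (M + e) * e}.
Proof.
move=> mu_ uM mv e0 uv.
pose w x := u x + Num.max (- e) (Num.min e (v x - u x)).
have wu x : `|w x - u x| <= e.
  rewrite /w addrAC subrr add0r ler_norml le_max lexx /=.
  by rewrite ge_max ge_min lexx /= andbT; lra.
have mw : measurable_fun setT w.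
  apply: measurable_funD => //; apply: measurable_maxr => //.
  by apply: measurable_minr => //; exact: measurable_funB.
have vw x : `|v x - u x| <= e -> v x = w x.
  by rewrite ler_norml /w => /andP[h1 h2]; rewrite (min_idPr _)// (max_idPr _)//;
    rewrite addrC subrK.
have vw_ae : v = w %[ae mu] by apply: filterS uv => x /vw.
apply: filterS uv => x uvx.
rewrite (nonlocal_op_ae_eq kg mv mw vw_ae (vw _ uvx)).
apply: (nonlocal_op_lipschitz_sup kg x mu_ mw) => //.
- by move=> y; rewrite (le_trans (uM y))// lerDl.
- move=> y; rewrite -(subrK (u y) (w y)) addrC (le_trans (ler_normD _ _))//.
  exact: lerD.
- by rewrite mulr_ge0// addr_ge0// (le_trans _ (uM x)).
Qed.

Section Local.
Variables (phi : T -> R) (m : R).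
Hypothesis phim : norm_le mu phi m.

(** On functions of norm at most 2 m, F is bounded by
    lip (2 m) * (2 m) = (4 + 8 C m) m, so the iterates need at least
    this time to move from norm m to norm 2 m. *)
Definition local_time : R := (4 + 8 * C * m)^-1.

Let m0 : 0 <= m. Proof. exact: norm_le_ge0 phim. Qed.
Let c0 : 0 < 4 + 8 * C * m.
Proof. by rewrite ltr_wpDr// !mulr_ge0. Qed.

Lemma local_time_gt0 : 0 < local_time.
Proof. by rewrite invr_gt0. Qed.

Lemma euler_local_bound n j : j%:R * h n <= local_time ->
  norm_le mu (E phi n j) (2 * m).
Proof.
move=> jS; suff H : norm_le mu (E phi n j) (m + j%:R * h n * ((4 + 8 * C * m) * m)).
  apply: norm_leW H; have : j%:R * h n <= local_time by [].
  rewrite -[leRHS]div1r ler_pdivlMr// => /(ler_wpM2r m0); lra.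
elim: j jS => [|j IH] jS; first by rewrite mulr0n !mul0r addr0.
have jS' : j%:R * h n <= local_time.
  by apply: le_trans jS; rewrite ler_pM2r ?mesh_gt0// ler_nat.
have {}IH := IH jS'.
have E2 : norm_le mu (E phi n j) (2 * m).
  apply: norm_leW IH; have : j%:R * h n <= local_time by [].
  rewrite -[leRHS]div1r ler_pdivlMr// => /(ler_wpM2r m0); lra.
have H := norm_leD IH (norm_leZ (h n) (norm_le_nonlocal_op E2)).
apply: norm_leW H; rewrite gtr0_norm ?mesh_gt0// -natr1.
by rewrite le_eqVlt; apply/orP; left; apply/eqP; ring.
Qed.

End Local.

Lemma euler_mass (phi : T -> R) (S M : R) n j :
  (forall k, k%:R * h n <= S -> norm_le mu (E phi n k) M) -> j%:R * h n <= S ->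
  (\int[mu]_x (E phi n j x)%:E = \int[mu]_x (phi x)%:E)%E.
Proof.
move=> HM; elim: j => [//|j IH] jS.
have jS' : j%:R * h n <= S.
  by apply: le_trans jS; rewrite ler_pM2r ?mesh_gt0// ler_nat.
rewrite -(IH jS'); have EM := HM _ jS'; have M0 := norm_le_ge0 EM.
have [_ Eb _] := EM.
have CM : 0 <= C * M by rewrite mulr_ge0.
by have [] := euler_step_mass kg (h n)
  (norm_le_integrable EM) Eb CM M0.
Qed.

(** The interval [a, b] contains the range of phi; with a = - A and b = A it
    expresses the maximum principle, with a = 0 or b = 0 the preservation of
    sign. *)
Section Global.
Variables (phi : T -> R) (A a b m : R).
Hypothesis phim : norm_le mu phi m.
Hypothesis CA1 : C * A <= 1.
Hypothesis aA : `|a| <= A.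
Hypothesis bA : `|b| <= A.
Hypothesis phiab : forall x, a <= phi x <= b.
Hypothesis Am : A <= m.

Let A0 : 0 <= A. Proof. exact: le_trans aA. Qed.

Let le_itv x : a <= x <= b -> `|x| <= A.
Proof.
move=> /andP[ax xb]; rewrite ler_norml.
move: aA bA; rewrite !ler_norml => /andP[? ?] /andP[? ?].
by apply/andP; split; lra.
Qed.

Lemma euler_global n j :
  [/\ measurable_fun setT (E phi n j), (forall x, a <= E phi n j x <= b) &
      (\int[mu]_x (`|E phi n j x|)%:E <= \int[mu]_x (`|phi x|)%:E)%E].
Proof.
have h01 : 0 <= h n <= 1 / 2 by rewrite mesh_le_half ltW ?mesh_gt0.
have CA : 0 <= C * A <= 1 by rewrite CA1 mulr_ge0.
elim: j => [|j [mE Eab EL]]; first by have [] := phim.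
have EA x : `|E phi n j x| <= A by exact: le_itv.
split.
- apply: measurable_funD => //; apply: measurable_funM => //.
  exact: (measurable_nonlocal_op kg mE EA).
- move=> x.
  exact: (euler_step_bounds kg mE EA CA1 h01 aA bA Eab).
- apply: le_trans (EL).
  apply: (euler_step_L1 kg _ EA) => //.
  apply/integrableP; split; first exact/measurable_EFinP.
  have [_ _ Im] := phim.
  by rewrite (le_lt_trans EL)// (le_lt_trans Im)// ltry.
Qed.

Lemma euler_global_bound n j : norm_le mu (E phi n j) m.
Proof.
have [mE Eab EL] := euler_global n j; split => // [x|].
  by apply: (le_trans (le_itv (Eab x))).
by have [_ _ Im] := phim; exact: le_trans Im.
Qed.

End Global.

End NonlocalEuler.

(** * Reflections of the Lebesgue measure *)

Section LebesgueReflection.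
Context {R : realType}.
Local Notation mu := (@lebesgue_measure R).

(** The reflection y |-> x - y turns half-open intervals around, which does not
    change their measure. *)
Lemma lebesgue_measure_reflection (x : R) (A : set R) : measurable A ->
  pushforward mu (fun y => x - y : measurableTypeR R) A = mu A.
Proof.
move=> mA; apply/esym/lebesgue_measure_unique => //=.
  exact: measurable_funB.
move=> mf _ [[a b]] _ <-; rewrite /pushforward.
rewrite (_ : _ @^-1` _ = `[x - b, x - a[%classic); last first.
  by apply/seteqP; split => y /=; rewrite !in_itv /= => /andP[? ?];
    apply/andP; split; lra.
rewrite !lebesgue_measure_itv /= !lte_fin.
rewrite (_ : (x - b < x - a) = (a < b)); last by apply/idP/idP; lra.
by case: ifP => // _; rewrite -!EFinD; congr EFin; ring.
Qed.

Let mrefl (x : R) : measurable_fun setT (fun y : R => x - y).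
Proof. exact: measurable_funB. Qed.

Lemma ge0_integral_reflection (x : R) (f : R -> R) : measurable_fun setT f ->
  (forall y, 0 <= f y) ->
  (\int[mu]_y (f (x - y))%:E = \int[mu]_y (f y)%:E)%E.
Proof.
move=> mf f0; have mfE : measurable_fun setT (EFin \o f) by exact/measurable_EFinP.
have := @ge0_integral_pushforward _ _ (measurableTypeR R) (measurableTypeR R) R
  _ (mrefl x) mu setT _ measurableT mfE.
rewrite preimage_setT => <-; last by move=> y _; rewrite lee_fin.
apply: eq_measure_integral => /=; first exact: mrefl.
by move=> _ A mA _; exact: lebesgue_measure_reflection.
Qed.

Lemma integral_reflection (x : R) (f : R -> R) :
  mu.-integrable setT (EFin \o f) ->
  (\int[mu]_y (f (x - y))%:E = \int[mu]_y (f y)%:E)%E.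
Proof.
move=> /integrableP[mfE fi].
have mf : measurable_fun setT f by exact/measurable_EFinP.
have mfx : measurable_fun setT (fun y : R => f (x - y)) by exact: measurableT_comp.
have ifx : mu.-integrable ((fun y : R => x - y) @^-1` setT)
    ((EFin \o f) \o (fun y : R => x - y)).
  rewrite preimage_setT; apply/integrableP; split; first exact/measurable_EFinP.
  rewrite /= (@ge0_integral_reflection x (fun y => `|f y|))//.
  exact: measurableT_comp.
have := @integral_pushforward _ _ (measurableTypeR R) (measurableTypeR R) R
  _ (mrefl x) mu setT _ mfE ifx measurableT.
rewrite preimage_setT => <-.
apply: eq_measure_integral => /=; first exact: mrefl.
by move=> _ A mA _; exact: lebesgue_measure_reflection.
Qed.

Lemma lebesgue_measureT_gt0 : (0 < mu setT)%E.
Proof. by rewrite -set_itvNyy lebesgue_measure_itv /= addye// ltry. Qed.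

End LebesgueReflection.

(** * Solutions of the equation on the line and their uniqueness *)

#[local] Instance lebesgue_ae_filter (R : realType) :
  Filter (nbhs (almost_everywhere (@lebesgue_measure R))).
Proof. exact: ae_filter_ringOfSetsType. Qed.

Section SolutionsOnTheLine.
Context {R : realType}.
Local Notation mu := (@lebesgue_measure R).

(** G has zero mass because, by oddness, reflection changes the sign of its
    integral. *)
Lemma convolution_kernels (K G : R -> R) (C : R) :
  K \in Lfun mu 1%E -> G \in Lfun mu 1%E ->
  (forall x, 0 <= K x) -> (forall x, K (- x) = K x) ->
  \int[mu]_x K x = 1 -> (forall x, G (- x) = - G x) ->
  0 < C -> (forall x, `|G x| <= C * K x) ->
  jump_kernels mu (fun x y => K (x - y)) (fun x y => G (x - y)) C.
Proof.
move=> /Lfun1_integrable iK /Lfun1_integrable iG K0 Keven K1 Godd C0 GK.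
have /integrableP[/measurable_EFinP mK _] := iK.
have /integrableP[/measurable_EFinP mG _] := iG.
have mB : measurable_fun setT
    (fun p : measurableTypeR R * measurableTypeR R => p.1 - p.2 : R).
  by apply: measurable_funB; [exact: measurable_fst|exact: measurable_snd].
split.
- exact: (measurableT_comp mK mB).
- exact: (measurableT_comp mG mB).
- by move=> x y; exact: K0.
- by move=> x y; rewrite -Keven opprB.
- move=> x; rewrite ge0_integral_reflection//.
  by rewrite -[LHS]fineK ?integrable_fin_num// -/(Rintegral _ _ _) K1.
- by move=> x y; rewrite -Godd opprB.
- move=> x; rewrite /Rintegral integral_reflection// -/(Rintegral mu setT G).
  have : \int[mu]_y G (0 - y) = \int[mu]_y G y.
    by rewrite /Rintegral integral_reflection.
  under eq_Rintegral do rewrite sub0r Godd -mulN1r.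
  by rewrite RintegralZl//; lra.
- by move=> x y; exact: GK.
- exact: ltW.
Qed.

Lemma ae_and (P Q : R -> Prop) : {ae mu, forall x, P x} ->
  {ae mu, forall x, Q x} -> {ae mu, forall x, P x /\ Q x}.
Proof. by move=> HP HQ; apply: filterS2 HP HQ. Qed.

Lemma Linfty_norm_leP (f : R -> R) (b : R) :
  ('N[mu]_+oo [EFin \o f] <= b%:E)%E <-> {ae mu, forall x, `|f x| <= b}.
Proof.
rewrite unlock /= lebesgue_measureT_gt0; split.
  by move=> /ess_supP; apply: filterS => x /=; rewrite lee_fin.
by move=> H; apply/ess_supP; apply: filterS H => x /=; rewrite lee_fin.
Qed.

Lemma L1Loo_norm_ge0 (f : R -> R) : (0 <= L1Loo_norm f)%E.
Proof. by rewrite adde_ge0// Lnorm_ge0. Qed.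

Lemma norm_le_L1Loo_norm (f : R -> R) (b : R) : norm_le mu f b ->
  (L1Loo_norm f <= (2 * b)%:E)%E.
Proof.
move=> [mf fb fi]; rewrite mulr_natl mulr2n EFinD; apply: leeD.
  by rewrite Lnorm1.
by apply/Linfty_norm_leP; apply: nearW.
Qed.

Lemma norm_le_L1Loo (f : R -> R) (b : R) : norm_le mu f b -> L1Loo f.
Proof.
move=> fb; have [mf fb' fi] := fb; split.
  apply/Lfun1_integrable; exact: norm_le_integrable fb.
rewrite inE; apply/andP; split; rewrite inE//=.
apply: (@le_lt_trans _ _ b%:E); last by rewrite ltry.
by apply/Linfty_norm_leP; apply: nearW.
Qed.

Lemma L1Loo_norm_ae (f : R -> R) (e : R) : (L1Loo_norm f <= e%:E)%E ->
  {ae mu, forall x, `|f x| <= e}.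
Proof.
move=> fe; apply/Linfty_norm_leP; apply: le_trans fe.
by rewrite /L1Loo_norm leeDr// Lnorm_ge0.
Qed.

Lemma L1Loo_measurable (f : R -> R) : L1Loo f -> measurable_fun setT f.
Proof. by move=> [/Lfun1_integrable /(measurable_int mu) /measurable_EFinP]. Qed.

Lemma cvge0P (D : set R) (t : R) (N : R -> \bar R) : (forall s, 0 <= N s)%E ->
  N s @[s --> within D (nbhs t)] --> 0%E <->
  forall e, 0 < e -> exists2 r, 0 < r &
    forall s, D s -> `|s - t| < r -> (N s <= e%:E)%E.
Proof.
move=> N0; split=> [/fine_cvgP[Nfin /cvgrPdist_le Ncvg] e e0|H].
  have [r /= r0 rP] := (nbhs_normP t (fun s => D s ->
    N s \is a fin_num /\ `|0 - fine (N s)| <= e)).1 (filterI Nfin (Ncvg _ e0)).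
  exists r => // s Ds str.
  have [|Ns] := rP s _ Ds; first by rewrite /ball /= distrC.
  by rewrite sub0r normrN ger0_norm ?fine_ge0// => Nse; rewrite -(fineK Ns) lee_fin.
have H' e : 0 < e -> \forall s \near within D (nbhs t), (N s <= e%:E)%E.
  move=> /H[r r0 rP]; rewrite near_withinE; apply/nbhs_normP; exists r => //= s st Ds.
  by apply: rP => //; rewrite distrC.
apply/fine_cvgP; split.
  apply: filterS (H' _ ltr01) => s Ns1.
  by rewrite ge0_fin_numE// (le_lt_trans Ns1)// ltry.
apply/cvgrPdist_le => e e0; apply: filterS (H' _ e0) => s Nse /=.
rewrite sub0r normrN ger0_norm ?fine_ge0// -lee_fin fineK//.
by rewrite ge0_fin_numE// (le_lt_trans Nse)// ltry.
Qed.

Lemma within_dnbhs (D : set R) (t : R) :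
  within D t^' = within [set s | D s /\ s != t] (nbhs t).
Proof.
have E1 P : (\forall s \near t, s != t -> D s -> P s) ->
    \forall s \near t, D s /\ s != t -> P s.
  by move=> H; near=> s => -[Ds st]; move: st Ds; near: s.
have E2 P : (\forall s \near t, D s /\ s != t -> P s) ->
    \forall s \near t, s != t -> D s -> P s.
  by move=> H; near=> s => st Ds; move: (conj Ds st); near: s.
by apply/seteqP; split => P HP; [exact: E1|exact: E2].
Unshelve. all: by end_near. Qed.

Lemma L1Loo_derivativeP (I : set R) (u : R -> R -> R) (t : R) (v : R -> R) :
  L1Loo_derivative I u t v <->
  forall e, 0 < e -> exists2 r, 0 < r &
    forall s, I s -> s != t -> `|s - t| < r ->
    (L1Loo_norm (fun x => (s - t)^-1 * (u s x - u t x) - v x)%R <= e%:E)%E.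
Proof.
rewrite /L1Loo_derivative within_dnbhs.
pose N (s : R) := L1Loo_norm (fun x => (s - t)^-1 * (u s x - u t x) - v x).
have N0 s : (0 <= N s)%E by exact: L1Loo_norm_ge0.
have H := @cvge0P [set s | I s /\ s != t] t N N0.
apply: (iff_trans H); split=> {}H e /H[r r0 rP]; exists r => // s.
  by move=> Is st; exact: rP.
by move=> [Is st]; exact: rP.
Qed.

Lemma L1Loo_continuousP (I : set R) (u : R -> R -> R) (t : R) :
  L1Loo_norm (u s \- u t) @[s --> within I (nbhs t)] --> 0%E <->
  forall e, 0 < e -> exists2 r, 0 < r &
    forall s, I s -> `|s - t| < r -> (L1Loo_norm (u s \- u t)%R <= e%:E)%E.
Proof.
pose N (s : R) := L1Loo_norm (u s \- u t).
have N0 s : (0 <= N s)%E by exact: L1Loo_norm_ge0.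
exact: (@cvge0P I t N N0).
Qed.

Lemma sub_is_solution (K G phi : R -> R) (I J : set R) u : J `<=` I ->
  is_solution K G phi I u -> is_solution K G phi J u.
Proof.
move=> JI [[uL uc] ud u0]; split => //.
- split; first by move=> t /JI; exact: uL.
  move=> t /JI /uc /L1Loo_continuousP H; apply/L1Loo_continuousP => e /H[r r0 rP].
  by exists r => // s /JI; exact: rP.
- move=> t /JI /ud /L1Loo_derivativeP H; apply/L1Loo_derivativeP => e /H[r r0 rP].
  by exists r => // s /JI; exact: rP.
Qed.

Lemma local_is_solution (K G phi : R -> R) (I : set R) (u : R -> R -> R) :
  u 0 = phi %[ae mu] ->
  (forall t, I t -> exists b, norm_le mu (u t) b) ->
  (forall t, I t -> exists D, 0 <= D /\ exists2 r, 0 < r &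
    forall s, I s -> `|s - t| < r ->
    norm_le mu (fun x => u s x - u t x) (D * `|s - t|) /\
    norm_le mu (fun x => u s x - u t x - (s - t) * nonlocal_rhs K G (u t) x)
      (D * (s - t) ^+ 2)) ->
  is_solution K G phi I u.
Proof.
move=> u0 ub ud; split => //.
- split; first by move=> t /ub[b]; exact: norm_le_L1Loo.
  move=> t It; have [D [D0 [r r0 rP]]] := ud t It.
  apply/L1Loo_continuousP => e e0.
  have D1 : 0 < 2 * D + 1 by rewrite ltr_wpDl// mulr_ge0.
  exists (Num.min r (e / (2 * D + 1))); first by rewrite lt_min r0 divr_gt0.
  move=> s Is; rewrite lt_min => /andP[sr]; rewrite ltr_pdivlMr// => se.
  have [H _] := rP s Is sr.
  apply: (le_trans (norm_le_L1Loo_norm H)); rewrite lee_fin.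
  apply: le_trans (ltW se); rewrite mulrA mulrC ler_wpM2l//.
  by rewrite lerDl.
- move=> t It; have [D [D0 [r r0 rP]]] := ud t It.
  apply/L1Loo_derivativeP => e e0.
  have D1 : 0 < 2 * D + 1 by rewrite ltr_wpDl// mulr_ge0.
  exists (Num.min r (e / (2 * D + 1))); first by rewrite lt_min r0 divr_gt0.
  move=> s Is st; rewrite lt_min => /andP[sr]; rewrite ltr_pdivlMr// => se.
  have st0 : s - t != 0 by rewrite subr_eq0.
  have [_ H] := rP s Is sr.
  have H1 := norm_leZ (s - t)^-1 H.
  have H2 : norm_le mu (fun x => (s - t)^-1 * (u s x - u t x) -
      nonlocal_rhs K G (u t) x) (D * `|s - t|).
    apply: norm_leW (eq_norm_le _ H1); last by move=> x; field.
    rewrite normfV -(real_normK (num_real (s - t))) expr2 mulrCA (mulrA `|s - t|^-1).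
    by rewrite mulVf ?normr_eq0// mul1r.
  apply: (le_trans (norm_le_L1Loo_norm H2)); rewrite lee_fin.
  apply: le_trans (ltW se); rewrite mulrA mulrC ler_wpM2l//.
  by rewrite lerDl.
Qed.

(** The part of the notion of solution on which uniqueness rests: the L^oo norm
    suffices, F being Lipschitz for it. *)
Lemma is_solution_near (K G phi : R -> R) (I : set R) u t e :
  is_solution K G phi I u -> I t -> 0 < e -> exists2 r, 0 < r &
    forall s, I s -> `|s - t| < r ->
    {ae mu, forall x, `|u s x - u t x| <= e} /\
    {ae mu, forall x, `|u s x - u t x - (s - t) * nonlocal_rhs K G (u t) x| <=
                      e * `|s - t|}.
Proof.
move=> [[uL uc] ud u0] It e0.
have /L1Loo_continuousP /(_ _ e0) [r1 r10 rc] := uc t It.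
have /L1Loo_derivativeP /(_ _ e0) [r2 r20 rd] := ud t It.
exists (Num.min r1 r2); first by rewrite lt_min r10.
move=> s Is; rewrite lt_min => /andP[s1 s2]; split.
  exact: L1Loo_norm_ae (rc s Is s1).
have [->|st] := eqVneq s t.
  by apply: nearW => x; rewrite !subrr mul0r subrr normr0 mulr0.
have := L1Loo_norm_ae (rd s Is st s2); apply: filterS => x.
have st0 : s - t != 0 by rewrite subr_eq0.
rewrite -[leLHS](mulrK (x := `|s - t|)) ?unitfE ?normr_eq0//.
rewrite ler_pdivrMr ?normr_gt0// -normrM => H.
by apply: le_trans H; rewrite le_eqVlt; apply/orP; left; apply/eqP;
  congr (`|_|); field.
Qed.

(** The competitor v is compared with a solution u bounded by M everywhere.
    While the essential distance d of v and u is at most 1, both are bounded by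
    M + 1 almost everywhere, so a single Lipschitz constant L serves
    for the whole interval. *)
Lemma solution_unique (K G phi : R -> R) (C S M : R) (u v : R -> R -> R) :
  jump_kernels mu (fun x y => K (x - y)) (fun x y => G (x - y)) C ->
  is_solution K G phi `[0, S] u -> is_solution K G phi `[0, S] v ->
  (forall t, 0 <= t <= S -> forall x, `|u t x| <= M) ->
  forall t, 0 <= t <= S -> v t = u t %[ae mu].
Proof.
move=> kg su sv uM t t0S.
have C0 := drift_ratio_ge0 kg.
have S0 : 0 <= S by case/andP: t0S => /le_trans; apply.
have M0 : 0 <= M by apply: le_trans (uM t t0S 0).
have II s : 0 <= s <= S -> `[0, S]%classic s by rewrite /= in_itv.
have mu_ s : 0 <= s <= S -> measurable_fun setT (u s).
  by move=> /II; have [[uL _] _ _] := su => /uL /L1Loo_measurable.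
have mv_ s : 0 <= s <= S -> measurable_fun setT (v s).
  by move=> /II; have [[vL _] _ _] := sv => /vL /L1Loo_measurable.
pose N s := ('N[mu]_+oo [EFin \o (fun x => (v s x - u s x)%R)])%E.
have Nfin s : 0 <= s <= S -> N s \is a fin_num.
  move=> /II Is; rewrite ge0_fin_numE ?Lnorm_ge0//.
  have [[uL _] _ _] := su; have [[vL _] _ _] := sv.
  have [_ u2] := uL _ Is; have [_ v2] := vL _ Is.
  have lty (f : R -> R) : f \in Lfun mu +oo%E -> ('N[mu]_+oo [EFin \o f] < +oo)%E.
    by rewrite inE => /andP[_]; rewrite inE.
  have [a aP] : exists a : R, {ae mu, forall x, `|u s x| <= a}.
    exists (fine ('N[mu]_+oo [EFin \o u s])%E); apply/Linfty_norm_leP.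
    by rewrite fineK// ge0_fin_numE ?Lnorm_ge0// lty.
  have [b bP] : exists b : R, {ae mu, forall x, `|v s x| <= b}.
    exists (fine ('N[mu]_+oo [EFin \o v s])%E); apply/Linfty_norm_leP.
    by rewrite fineK// ge0_fin_numE ?Lnorm_ge0// lty.
  apply: (@le_lt_trans _ _ (a + b)%:E); last by rewrite ltry.
  apply/Linfty_norm_leP; apply: filterS2 aP bP => x xa xb.
  by rewrite (le_trans (ler_normB _ _))// addrC lerD.
pose d s := fine (N s).
have dP s : 0 <= s <= S -> {ae mu, forall x, `|v s x - u s x| <= d s}.
  by move=> Is; apply/Linfty_norm_leP; rewrite fineK ?Nfin.
have d_ge0 s : 0 <= d s by rewrite fine_ge0// Lnorm_ge0.
have dle s b : 0 <= s <= S -> {ae mu, forall x, `|v s x - u s x| <= b} -> d s <= b.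
  by move=> Is /Linfty_norm_leP; rewrite -lee_fin fineK ?Nfin.
suff dt : d t <= 0.
  have := dP t t0S; apply: filterS => x vu _; apply/eqP.
  by rewrite -subr_eq0 -normr_le0 (le_trans vu).
pose L := 2 * (1 + C * (M + 1)).
have L0 : 0 <= L by rewrite /L mulr_ge0// addr_ge0// mulr_ge0// addr_ge0.
apply: (gronwall_zero L0 _ _ _ t0S).
- apply: dle; first by rewrite lexx.
  have [_ _ u0] := su; have [_ _ v0] := sv.
  by apply: filterS2 u0 v0 => x -> // -> //; rewrite subrr normr0.
- move=> r r0 rS dr1 e e0.
  have Ir : 0 <= r <= S by rewrite r0 ltW.
  have e2 : 0 < e / 2 by rewrite divr_gt0.
  have [ru ru0 ruP] := is_solution_near su (II _ Ir) e2.
  have [rv rv0 rvP] := is_solution_near sv (II _ Ir) e2.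
  exists (Num.min ru rv); first by rewrite lt_min ru0.
  move=> s rs; rewrite -ltrBlDl lt_min => /andP[sru srv] sS.
  have Is : 0 <= s <= S by rewrite sS andbT (le_trans r0)// ltW.
  have nsr : `|s - r| = s - r by rewrite gtr0_norm// subr_gt0.
  rewrite -nsr in sru srv.
  have [_ hu] := ruP s (II _ Is) sru.
  have [_ hv] := rvP s (II _ Is) srv.
  apply: dle => //.
  have hF : {ae mu, forall x, `|nonlocal_rhs K G (v r) x - nonlocal_rhs K G (u r) x|
      <= 2 * (1 + C * (M + d r)) * d r}.
    exact: (nonlocal_op_ae_lipschitz kg (mu_ _ Ir) (uM _ Ir) (mv_ _ Ir) (d_ge0 r)
      (dP _ Ir)).
  have := ae_and (ae_and hu hv) (ae_and hF (dP _ Ir)).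
  apply: filterS => x /= [[xu xv] [xF xd]].
  rewrite nsr in xu xv.
  set Fu := nonlocal_rhs K G (u r) x in xu.
  set Fv := nonlocal_rhs K G (v r) x in xv.
  have xF' : `|Fv - Fu| <= L * d r.
    apply: (le_trans xF); rewrite ler_wpM2r// /L ler_pM2l// lerD2l.
    by rewrite ler_wpM2l// lerD2l.
  have -> : v s x - u s x = (v r x - u r x) + (s - r) * (Fv - Fu) +
     ((v s x - v r x - (s - r) * Fv) - (u s x - u r x - (s - r) * Fu)) by ring.
  apply: (le_trans (ler_normD _ _)).
  have h1 := ler_normB (v s x - v r x - (s - r) * Fv) (u s x - u r x - (s - r) * Fu).
  have h2 := ler_normD (v r x - u r x) ((s - r) * (Fv - Fu)).
  have h3 : `|(s - r) * (Fv - Fu)| <= (s - r) * (L * d r).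
    by rewrite normrM nsr ler_wpM2l// subr_ge0 ltW.
  apply: (le_trans (lerD (le_trans h2 (lerD xd h3)) (le_trans h1 (lerD xv xu)))).
  by rewrite le_eqVlt; apply/orP; left; apply/eqP; field.
- move=> r r0 rS e e0.
  have Ir : 0 <= r <= S by rewrite rS ltW.
  have e2 : 0 < e / 2 by rewrite divr_gt0.
  have [ru ru0 ruP] := is_solution_near su (II _ Ir) e2.
  have [rv rv0 rvP] := is_solution_near sv (II _ Ir) e2.
  exists (Num.min ru rv); first by rewrite lt_min ru0.
  move=> s; rewrite ltrBlDr -ltrBlDl lt_min => /andP[sru srv] sr s0.
  have Is : 0 <= s <= S by rewrite s0 (le_trans _ rS)// ltW.
  have nsr : `|s - r| = r - s by rewrite distrC gtr0_norm// subr_gt0.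
  rewrite -nsr in sru srv.
  have [hu _] := ruP s (II _ Is) sru.
  have [hv _] := rvP s (II _ Is) srv.
  apply: dle => //; have := ae_and (ae_and hu hv) (dP _ Is).
  apply: filterS => x /= [[xu xv] xd].
  have -> : v r x - u r x = (v s x - u s x) + ((u s x - u r x) - (v s x - v r x)) by ring.
  apply: (le_trans (ler_normD _ _)); apply: lerD => //.
  apply: (le_trans (ler_normB _ _)); apply: (le_trans (lerD xu xv)); lra.
Qed.

End SolutionsOnTheLine.

(** * Existence, global solutions and invariants *)

Section EulerSolution.
Context {R : realType}.
Local Notation mu := (@lebesgue_measure R).
Variables (K G psi : R -> R) (C : R).
Hypothesis kg : jump_kernels mu (fun x y => K (x - y)) (fun x y => G (x - y)) C.
Local Notation w := (euler_limit (nonlocal_rhs K G) psi).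
Local Notation E n := (euler (nonlocal_rhs K G) psi (mesh n)).

(** The a priori bound on which the existence of a solution up to time S
    rests. *)
Definition euler_bounded (S M : R) :=
  forall n k, k%:R * mesh n <= S -> norm_le mu (E n k) M.

Let C0 : 0 <= C. Proof. exact: drift_ratio_ge0 kg. Qed.

Let M_ge0 S M : 0 <= S -> euler_bounded S M -> 0 <= M.
Proof. by move=> S0 /(_ 0%N 0%N); rewrite mul0r => /(_ S0)/norm_le_ge0. Qed.

Let lip_ge0 M : 0 <= M -> 0 <= 2 * (1 + C * M).
Proof. by move=> M0; rewrite mulr_ge0// addr_ge0// mulr_ge0. Qed.

Let F_lip M v u e : norm_le mu v M -> norm_le mu u M ->
  norm_le mu (fun x => u x - v x) e ->
  norm_le mu (fun x => nonlocal_rhs K G u x - nonlocal_rhs K G v x)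
    (2 * (1 + C * M) * e).
Proof. exact: (norm_le_nonlocal_opB kg). Qed.

Let F_bound M v : norm_le mu v M ->
  norm_le mu (nonlocal_rhs K G v) (2 * (1 + C * M) * M).
Proof. exact: (norm_le_nonlocal_op kg). Qed.

Lemma euler_solution_bound S M t : euler_bounded S M -> 0 <= t <= S ->
  norm_le mu (w t) M.
Proof.
move=> SM tS; have S0 : 0 <= S by case/andP: tS => /le_trans; apply.
exact: (euler_limit_bound (lip_ge0 (M_ge0 S0 SM)) S0 (@F_lip M) (@F_bound M) SM).
Qed.

Lemma euler_solution_mass S M t : euler_bounded S M -> 0 <= t <= S ->
  (\int[mu]_x (w t x)%:E = \int[mu]_x (psi x)%:E)%E.
Proof.
move=> SM tS; have S0 : 0 <= S by case/andP: tS => /le_trans; apply.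
apply: (euler_limit_mass (lip_ge0 (M_ge0 S0 SM)) S0 (@F_lip M) (@F_bound M) SM tS).
move=> n k kS; exact: (euler_mass kg (fun j => SM n j) kS).
Qed.

Lemma euler_solution_itv S M t a b : euler_bounded S M -> 0 <= t <= S ->
  (forall n k x, a <= E n k x <= b) -> forall x, a <= w t x <= b.
Proof.
move=> SM tS H; have S0 : 0 <= S by case/andP: tS => /le_trans; apply.
apply: (euler_limit_itv (lip_ge0 (M_ge0 S0 SM)) S0 (@F_lip M) (@F_bound M) SM tS).
by move=> n k _; exact: H.
Qed.

Lemma euler_solution_L1 S M t c : euler_bounded S M -> 0 <= t <= S ->
  (forall n k, \int[mu]_x (`|E n k x|)%:E <= c)%E ->
  (\int[mu]_x (`|w t x|)%:E <= c)%E.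
Proof.
move=> SM tS H; have S0 : 0 <= S by case/andP: tS => /le_trans; apply.
apply: (euler_limit_L1 (lip_ge0 (M_ge0 S0 SM)) S0 (@F_lip M) (@F_bound M) SM tS).
by move=> n k _; exact: H.
Qed.

(** The horizon S may depend on t, provided no nearby time of I exceeds it:
    this covers unbounded intervals, where no single S would do. *)
Lemma euler_is_solution (phi : R -> R) (I : set R) : psi = phi %[ae mu] ->
  (forall t, I t -> 0 <= t) ->
  (forall t, I t -> exists S M, euler_bounded S M /\ exists2 r, 0 < r &
    forall s, I s -> `|s - t| < r -> s <= S) ->
  is_solution K G phi I w.
Proof.
move=> psiphi I0 HI; apply: local_is_solution.
- by rewrite euler_limit0.
- move=> t It; have [S [M [SM [r r0 rS]]]] := HI t It; exists M.
  apply: (euler_solution_bound SM); rewrite I0//= rS//.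
  by rewrite subrr normr0.
- move=> t It; have [S [M [SM [r r0 rS]]]] := HI t It.
  have tS : 0 <= t <= S by rewrite I0//= rS// subrr normr0.
  have S0 : 0 <= S by case/andP: tS => /le_trans; apply.
  have [D [D0 DP]] := euler_limit_differentiable (lip_ge0 (M_ge0 S0 SM)) S0
    (@F_lip M) (@F_bound M) SM.
  exists D; split => //; exists r => // s Is sr.
  by apply: DP => //; rewrite I0//= rS.
Qed.

End EulerSolution.

Theorem theorem1p1 (R : realType) (K G : R -> R) (CGK : R)
    (K_L1 : K \in Lfun (@lebesgue_measure R) 1%E)
    (G_L1 : G \in Lfun (@lebesgue_measure R) 1%E)
    (K_ge0 : forall x, 0 <= K x)
    (K_even : forall x, K (- x) = K x)
    (K_int : \int[@lebesgue_measure R]_x K x = 1)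
    (G_odd : forall x, G (- x) = - G x)
    (CGK_gt0 : 0 < CGK)
    (GK : forall x, `|G x| <= CGK * K x)
    (phi : R -> R) (phi_L1Loo : L1Loo phi) :
  exists (Tmax : R) (u : R -> R -> R),
    [/\ 0 < Tmax,
        is_unique_solution K G phi `[0, Tmax] u,
        conserves_mass phi `[0, Tmax] u &
        ('N[@lebesgue_measure R]_+oo [EFin \o phi] < (1 / CGK)%:E)%E ->
        exists w : R -> R -> R,
          [/\ (forall t, 0 <= t <= Tmax ->
                 w t = u t %[ae (@lebesgue_measure R)]),
              is_unique_solution K G phi `[0, +oo[ w,
              conserves_mass phi `[0, +oo[ w,
              ({ae @lebesgue_measure R, forall x, 0 <= phi x} ->
               forall t, 0 <= t ->
                 {ae @lebesgue_measure R, forall x, 0 <= w t x}) /\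
              ({ae @lebesgue_measure R, forall x, phi x <= 0} ->
               forall t, 0 <= t ->
                 {ae @lebesgue_measure R, forall x, w t x <= 0}) &
              forall t, 0 <= t ->
                ('N[@lebesgue_measure R]_1 [EFin \o w t] <=
                   'N[@lebesgue_measure R]_1 [EFin \o phi])%E /\
                ('N[@lebesgue_measure R]_+oo [EFin \o w t] <=
                   'N[@lebesgue_measure R]_+oo [EFin \o phi])%E]].
Proof.
have kg := convolution_kernels K_L1 G_L1 K_ge0 K_even K_int G_odd CGK_gt0 GK.
set mu := @lebesgue_measure R in phi_L1Loo *.
have mphi := L1Loo_measurable phi_L1Loo.
have [/Lfun1_integrable iphi phioo] := phi_L1Loo.
pose A := fine ('N[mu]_+oo [EFin \o phi])%E.
have AE : 'N[mu]_+oo [EFin \o phi]%E = A%:E.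
  rewrite fineK// ge0_fin_numE ?Lnorm_ge0//.
  by move: phioo; rewrite inE => /andP[_]; rewrite inE.
have A0 : 0 <= A by rewrite fine_ge0// Lnorm_ge0.
have phiA : {ae mu, forall x, `|phi x| <= A} by apply/Linfty_norm_leP; rewrite AE.
(* One pair of bounds serves both the maximum principle and the signs: 0 on
   the side where phi has a sign, the essential bound A otherwise. *)
pose a := if `[< {ae mu, forall x, 0 <= phi x} >] then 0 else - A.
pose b := if `[< {ae mu, forall x, phi x <= 0} >] then 0 else A.
have aA : `|a| <= A by rewrite /a; case: ifP => _; rewrite ?normrN ger0_norm.
have bA : `|b| <= A by rewrite /b; case: ifP => _; rewrite ger0_norm.
have a0 : a <= 0 by rewrite /a; case: ifP => _ //; rewrite oppr_le0.
have b0 : 0 <= b by rewrite /b; case: ifP.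
have phia : {ae mu, forall x, a <= phi x}.
  rewrite /a; case: asboolP => // _.
  by apply: filterS phiA => x; rewrite ler_norml => /andP[].
have phib : {ae mu, forall x, phi x <= b}.
  rewrite /b; case: asboolP => // _.
  by apply: filterS phiA => x; rewrite ler_norml => /andP[].
(* A representative of phi satisfying these bounds at every point. *)
pose psi x := Num.max a (Num.min b (phi x)).
have mpsi : measurable_fun setT psi.
  by apply: measurable_maxr => //; exact: measurable_minr.
have psiphi : psi = phi %[ae mu].
  apply: filterS (ae_and phia phib) => x [ax bx] _.
  by rewrite /psi (min_idPr bx) (max_idPr ax).
have psiab x : a <= psi x <= b.
  by rewrite /psi le_max lexx /= ge_max (le_trans a0 b0) /= ge_min lexx.
have psiL1 : (\int[mu]_x (`|psi x|)%:E = \int[mu]_x (`|phi x|)%:E)%E.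
  apply: ae_eq_integral => //.
  - by apply/measurable_EFinP; exact: measurableT_comp.
  - by apply/measurable_EFinP; exact: measurableT_comp.
  - by apply: filterS psiphi => x /= + _ => ->.
have psimass : (\int[mu]_x (psi x)%:E = \int[mu]_x (phi x)%:E)%E.
  apply: ae_eq_integral => //; try exact/measurable_EFinP.
  by apply: filterS psiphi => x /= + _ => ->.
have /integrableP[_ phifin] := iphi.
pose m := Num.max A (fine (\int[mu]_x (`|phi x|)%:E)%E).
have Am : A <= m by rewrite /m le_max lexx.
have psim : norm_le mu psi m.
  split => //.
  - move=> x; apply: le_trans Am; rewrite ler_norml.
    have /andP[p1 p2] := psiab x.
    move: aA bA; rewrite !ler_norml => /andP[? ?] /andP[? ?].
    by apply/andP; split; lra.
  - rewrite psiL1 -[leLHS]fineK ?lee_fin ?le_max ?lexx ?orbT//.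
    by rewrite ge0_fin_numE// integral_ge0.
pose T := local_time CGK m.
have T0 : 0 < T by exact: (local_time_gt0 kg psim).
have HT : euler_bounded K G psi T (2 * m).
  by move=> n k; exact: (euler_local_bound kg psim).
pose w := euler_limit (nonlocal_rhs K G) psi.
(* The same limit serves as local and as global solution. *)
exists T, w; split => //.
- have sol : is_solution K G phi `[0, T] w.
    apply: (euler_is_solution kg psiphi).
      by move=> t /=; rewrite in_itv => /andP[].
    move=> t _; exists T, (2 * m); split => //; exists 1 => // s.
    by rewrite /= in_itv => /andP[].
  split; first exact: sol.
  move=> v solv t; rewrite /= in_itv => tT.
  apply: (solution_unique kg sol solv _ tT) => s sT.
  by have [_ ? _] := euler_solution_bound kg HT sT.
- move=> t; rewrite /= in_itv => tT; rewrite /Rintegral.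
  by rewrite (euler_solution_mass kg HT tT) psimass.
rewrite AE lte_fin ltr_pdivlMr// mulrC => /ltW CA1.
have glob := euler_global kg psim CA1 aA bA psiab.
have HG S : euler_bounded K G psi S m.
  by move=> n k _; exact: (euler_global_bound kg psim CA1 aA bA psiab Am).
have wab t : 0 <= t -> forall x, a <= w t x <= b.
  move=> t0; apply: (euler_solution_itv kg (HG t)); first by rewrite t0 lexx.
  by move=> n k x; have [_ /(_ x)] := glob n k.
exists w; split.
- by move=> t _; apply: nearW.
- have sol : is_solution K G phi `[0, +oo[ w.
    apply: (euler_is_solution kg psiphi).
      by move=> t /=; rewrite in_itv /= andbT.
    move=> t _; exists (t + 1), m; split => //; exists 1 => // s _.
    by rewrite -lerBlDl => /(le_lt_trans (ler_norm _))/ltW.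
  split; first exact: sol.
  move=> v solv t; rewrite /= in_itv /= andbT => t0.
  have sub : `[0, t]%classic `<=` `[0, +oo[%classic.
    by move=> s /=; rewrite !in_itv /= => /andP[->].
  apply: (solution_unique kg (sub_is_solution sub sol) (sub_is_solution sub solv) (M := m)).
    by move=> s st; have [_ ? _] := euler_solution_bound kg (HG t) st.
  by rewrite t0 lexx.
- move=> t; rewrite /= in_itv /= andbT => t0; rewrite /Rintegral.
  by rewrite (euler_solution_mass kg (HG t)) ?psimass// t0 lexx.
- split=> [phi0|phi0] t t0; apply: nearW => x; have /andP[wa wb] := wab t t0 x.
    by move: wa; rewrite /a; case: asboolP.
  by move: wb; rewrite /b; case: asboolP.
- move=> t t0; split.
    rewrite !Lnorm1 /= -psiL1; apply: (euler_solution_L1 kg (HG t)).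
      by rewrite t0 lexx.
    by move=> n k; have [] := glob n k.
  apply/Linfty_norm_leP; apply: nearW => x.
  rewrite ler_norml; have /andP[p1 p2] := wab t t0 x.
  move: aA bA; rewrite !ler_norml => /andP[? ?] /andP[? ?].
  by apply/andP; split; lra.
Qed.
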